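(* There exists $N_0\ge 16$ such that for every integer $N\ge N_0$ and every $\rho\in[2/3,1)$ the following hold for the kernel $K_\flat$, the operator $H_\flat$ and the measures $\widehat\omega,\widehat\sigma$ defined in the context: (i) $K_\flat$ is odd, smooth on $\mathbb R\setminus\{0\}$, the convolution kernel $K(x,y)=K_\flat(x-y)$ is a standard Calderón–Zygmund kernel, and $K_\flat$ is elliptic: there are constants $0<c\le C<\infty$ (depending on $N$) with $c/|x|\le |K_\flat(x)|\le C/|x|$ for all $x\ne0$; (ii) $H_\flat$ is bounded from $L^2(\widehat\sigma)$ to $L^2(\widehat\omega)$, in the (dual) form: there is $C<\infty$ with $$\int \big|H_\flat(g\widehat\omega)\big|^2\,d\widehat\sigma\le C\int|g|^2\,d\widehat\omega\qquad\text{for all }g\in L^2(\widehat\omega),$$ where $H_\flat(g\widehat\omega)(y)=\int K_\flat(y-x)g(x)\,d\widehat\omega(x)$ is absolutely convergent for every $y$ in the support of $\widehat\sigma$; (iii) the pair $(\widehat\sigma,\widehat\omega)$ fails the backward energy condition: $$\sup\ \frac{1}{|I_0|_{\widehat\omega}}\sum_{r\ge1}|I_r|_{\widehat\sigma}\,\mathsf E(I_r,\widehat\sigma)^2\,\mathrm P(I_r,\mathbf 1_{I_0}\widehat\omega)^2=\infty,$$ the supremum being over all intervals $I_0$ with $|I_0|_{\widehat\omega}>0$ and all decompositions $I_0=\bigcup_{r\ge1}I_r$ into pairwise disjoint intervals (terms with $|I_r|_{\widehat\sigma}=0$ are taken to be $0$).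
   Context: Notation: for a positive Borel measure $\mu$ and interval $I$, $|I|_\mu=\mu(I)$, $|I|$ is Lebesgue length. Poisson integral: $\mathrm P(I,\mu)=\int_{\mathbb R}\frac{|I|}{(|I|+\operatorname{dist}(x,I))^2}\,d\mu(x)$. Energy: for $|I|_\mu>0$, $\mathsf E(I,\mu)^2=\frac12\,\frac{1}{|I|_\mu^2}\int_I\int_I\frac{(x-x')^2}{|I|^2}\,d\mu(x)\,d\mu(x')$. A standard Calderón–Zygmund kernel on $\mathbb R$ is a real function $K(x,y)$ on $x\neq y$ with $|K(x,y)|\le C|x-y|^{-1}$, $|\nabla K(x,y)|\le C|x-y|^{-2}$, and $|\nabla K(x,y)-\nabla K(x',y)|\le C(|x-x'|/|x-y|)^\delta|x-y|^{-2}$ whenever $|x-x'|\le\frac12|x-y|$, for some $\delta>0$, and the same with the roles of $x,y$ interchanged. Cantor intervals: fix an integer $N\ge16$ and $\rho\in[2/3,1)$. Set $I^0_1=[0,1]$. Each interval $I=[a,a+N^{-k}]$ of generation $k$ has two children of generation $k+1$: the left child $I_-=[a,a+N^{-k-1}]$ and the right child $I_+=[a+N^{-k}-N^{-k-1},a+N^{-k}]$. The $2^k$ intervals of generation $k$ are denoted $I^k_j$, $1\le j\le 2^k$, numbered left to right; $\mathcal D$ is the collection of all of them. $G^k_j$ is the open middle gap $I^k_j\setminus((I^k_j)_-\cup(I^k_j)_+)$, $\dot z^k_j$ is the common center of $I^k_j$ and $G^k_j$, and $L^k_j=[\dot z^k_j-N^{-k-1},\dot z^k_j+N^{-k-1}]$.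 The Cantor set is $\mathsf E^{(N)}=\bigcap_{k}\bigcup_{j}I^k_j$. Redistributed Cantor measure: with $\eta=1/N$, $\widehat\omega$ is the unique Borel probability measure supported on $\mathsf E^{(N)}$ such that $\widehat\omega(I^1_1)=\widehat\omega(I^1_2)=\frac12$ and for every $I\in\mathcal D$ of generation $\ge1$: if $I$ is the left child of its parent then $\widehat\omega(I_-)=\frac{1+\eta}2\widehat\omega(I)$, $\widehat\omega(I_+)=\frac{1-\eta}2\widehat\omega(I)$; if $I$ is the right child of its parent then $\widehat\omega(I_-)=\frac{1-\eta}2\widehat\omega(I)$, $\widehat\omega(I_+)=\frac{1+\eta}2\widehat\omega(I)$. Weights: $\widehat s^k_j=N^{-2k}/\widehat\omega(I^k_j)$ (so $\widehat\omega(I^k_j)\,\widehat s^k_j=|I^k_j|^2$); $\widehat{\dot\sigma}=\sum_{k\ge0}\sum_{j=1}^{2^k}\widehat s^k_j\,\delta_{\dot z^k_j}$ and $\widehat\sigma=\sum_{k\ge0}\sum_{j=1}^{2^k}\widehat s^k_j\,|L^k_j|^{-1}\mathbf 1_{L^k_j}(x)\,dx$. Flattened kernel: $K_\flat$ is defined first on $[N^{-1/2},N^{1/2}]$ as a smooth nonincreasing function with values in $[N^{-1/2},N^{1/2}]$ such that $K_\flat(x)=1/x$ for $N^{-1/2}\le x\le(\rho N)^{-1/2}$ and for $(\rho N)^{1/2}\le x\le N^{1/2}$, and $K_\flat(x)=1$ for $(\rho^2N)^{-1/2}\le x\le(\rho^2N)^{1/2}$; then extended to $(0,\infty)$ by $K_\flat(x)=N^{-k}K_\flat(N^{-k}x)$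 for $x\in[N^{k-1/2},N^{k+1/2}]$, $k\in\mathbb Z$, and to $\mathbb R\setminus\{0\}$ as an odd function. $H_\flat\mu(x)=\int K_\flat(x-y)\,d\mu(y)$ (with the usual truncations when needed).
   Formalization: In (ii), absolute convergence is asserted for y in the union of the intervals L^k_j, not in the closed support of σ̂, which also contains the σ̂-null Cantor set; there it fails already for g=1 (for instance at y=0). *)

(* Defs.v *)
From HB Require Import structures.
From mathcomp Require Import all_boot all_order all_algebra.
From mathcomp Require Import all_classical all_reals all_analysis.
Set Implicit Arguments. Unset Strict Implicit. Unset Printing Implicit Defensive.
Import Order.TTheory GRing.Theory Num.Theory.
Import numFieldNormedType.Exports.
Local Open Scope classical_set_scope.
Local Open Scope ring_scope.

Section Defs.
Variable R : realType.

Definition Npow (N k : nat) : R := (N%:R ^+ k)^-1.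

(** Cantor intervals, 0-based index j < 2^k (the paper's I^k_{j+1}).
    Children of (k,j) are (k+1,2j) (left) and (k+1,2j+1) (right). *)
Fixpoint cantor_left (N k j : nat) : R :=
  match k with
  | 0 => 0
  | k'.+1 => cantor_left N k' j./2 + (if odd j then Npow N k' - Npow N k'.+1 else 0)
  end.

Definition cantor_int (N k j : nat) : set R :=
  `[cantor_left N k j, cantor_left N k j + Npow N k].

Definition cantor_center (N k j : nat) : R := cantor_left N k j + Npow N k / 2.

Definition Lint (N k j : nat) : set R :=
  `[cantor_center N k j - Npow N k.+1, cantor_center N k j + Npow N k.+1].

Definition cantor_set (N : nat) : set R :=
  \bigcap_(k in [set: nat]) \bigcup_(j in [set j | (j < 2 ^ k)%N]) cantor_int N k j.

(** The redistributed Cantor measure: Borel probability measure supported on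
    the Cantor set with the prescribed masses (this determines it uniquely). *)
Definition omega_hat_spec (N : nat) (omega : {measure set R -> \bar R}) : Prop :=
  let eta : R := (N%:R)^-1 in
  omega setT = 1%E /\ omega (~` cantor_set N) = 0%E /\
  omega (cantor_int N 1 0) = (1/2)%:E /\ omega (cantor_int N 1 1) = (1/2)%:E /\
  (forall k j : nat, (1 <= k)%N -> (j < 2 ^ k)%N ->
     omega (cantor_int N k.+1 j.*2)
       = (((if odd j then 1 - eta else 1 + eta) / 2)%:E * omega (cantor_int N k j))%E /\
     omega (cantor_int N k.+1 j.*2.+1)
       = (((if odd j then 1 + eta else 1 - eta) / 2)%:E * omega (cantor_int N k j))%E).

Definition s_hat (N : nat) (omega : {measure set R -> \bar R}) (k j : nat) : R :=
  Npow N k ^+ 2 / fine (omega (cantor_int N k j)).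

Definition sigma_hat_spec (N : nat) (omega sigma : {measure set R -> \bar R}) : Prop :=
  forall A : set R, measurable A ->
    sigma A = (\sum_(k <oo) \sum_(0 <= j < 2 ^ k)
                 ((s_hat N omega k j / (2 * Npow N k.+1))%:E
                  * lebesgue_measure (A `&` Lint N k j)))%E.

Definition Kflat_spec (N : nat) (rho : R) (K : R -> R) : Prop :=
  let s := Num.sqrt (N%:R : R) in
  (forall (n : nat) (x : R), s^-1 < x < s -> derivable (derive1n n K) x 1) /\
  (forall x y : R, s^-1 <= x -> x <= y -> y <= s -> K y <= K x) /\
  (forall x : R, s^-1 <= x <= s -> s^-1 <= K x <= s) /\
  (forall x : R, s^-1 <= x <= (Num.sqrt (rho * N%:R))^-1 -> K x = x^-1) /\
  (forall x : R, Num.sqrt (rho * N%:R) <= x <= s -> K x = x^-1) /\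
  (forall x : R, (Num.sqrt (rho ^+ 2 * N%:R))^-1 <= x <= Num.sqrt (rho ^+ 2 * N%:R) ->
                 K x = 1) /\
  (forall (k : int) (x : R), (N%:R) ^ k / s <= x <= (N%:R) ^ k * s ->
                 K x = (N%:R) ^ (- k) * K ((N%:R) ^ (- k) * x)) /\
  (forall x : R, x != 0 -> K (- x) = - K x).

Definition grad_norm (F : R * R -> R) (p : R * R) : R :=
  Num.sqrt (('d F p (1, 0)) ^+ 2 + ('d F p (0, 1)) ^+ 2).

Definition grad_dist (F : R * R -> R) (p q : R * R) : R :=
  Num.sqrt (('d F p (1, 0) - 'd F q (1, 0)) ^+ 2 + ('d F p (0, 1) - 'd F q (0, 1)) ^+ 2).

Definition std_CZ_kernel (Kxy : R -> R -> R) : Prop :=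
  let F := fun p : R * R => Kxy p.1 p.2 in
  exists (C delta : R), 0 < C /\ 0 < delta /\
  forall x y : R, x != y ->
    differentiable F (x, y) /\
    `|Kxy x y| <= C / `|x - y| /\
    grad_norm F (x, y) <= C / `|x - y| ^+ 2 /\
    (forall x' : R, `|x - x'| <= `|x - y| / 2 ->
       grad_dist F (x, y) (x', y) <= C * (`|x - x'| / `|x - y|) `^ delta / `|x - y| ^+ 2) /\
    (forall y' : R, `|y - y'| <= `|x - y| / 2 ->
       grad_dist F (x, y) (x, y') <= C * (`|y - y'| / `|x - y|) `^ delta / `|x - y| ^+ 2).

Definition bounded_itv (I : interval R) : Prop :=
  match I with Interval (BSide _ _) (BSide _ _) => True | _ => False end.

Definition itv_len (I : interval R) : R :=
  match I with Interval (BSide _ a) (BSide _ c) => c - a | _ => 0 end.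

Definition itv_dist (I : interval R) (x : R) : R :=
  match I with
  | Interval (BSide _ a) (BSide _ c) => Num.max 0 (Num.max (a - x) (x - c))
  | _ => 0 end.

Definition poisson (I : interval R) (mu : {measure set R -> \bar R}) (A : set R) : \bar R :=
  (\int[mu]_(x in A) (itv_len I / (itv_len I + itv_dist I x) ^+ 2)%:E)%E.

Definition energy2 (I : interval R) (mu : {measure set R -> \bar R}) : \bar R :=
  (((fine (mu [set` I]))^-2 / 2)%:E *
   \int[mu]_(x in [set` I]) \int[mu]_(x' in [set` I]) (((x - x') / itv_len I) ^+ 2)%:E)%E.

Definition benergy_term (sigma omega : {measure set R -> \bar R}) (I0 Ir : interval R)
  : \bar R :=
  if sigma [set` Ir] == 0%E then 0%E
  else (sigma [set` Ir] * energy2 Ir sigma * (poisson Ir omega [set` I0] * poisson Ir omega [set` I0]))%E.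

End Defs.

(* Main.v *)
(** Since K (N x) = K x / N, everything in (i) reduces to the fundamental
    period [N^-1/2, N^1/2].  On the supports, K is evaluated only in its
    plateaux: for y in L^k_j it equals +-N^k on the two children of I^k_j and
    +-N^m on the sibling of each ancestor of generation m+1.  Hence H(g omega) is
    a constant h(k,j) on L^k_j.  The redistribution of mass (1 +- eta)/2 makes the
    increments h(k+1,j) - h(k,j/2) multiples of the martingale differences of
    g with respect to omega, so that the sum of s * (increment)^2 is at most
    int g^2 d omega by orthogonality, while passing to the children divides the
    total weight s by at least 4; the two facts sum to (ii).  For (iii), [0,1] is cut
    into the gaps of generation < n and the intervals of generation n: each
    gap G^k_j contributes at least omega(I^k_j) / (32 N^2), hence the sum is
    at least n / (32 N^2). *)

Require Import Defs.
From HB Require Import structures.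
From mathcomp Require Import all_boot all_order all_algebra.
From mathcomp Require Import all_classical all_reals all_analysis.
From mathcomp Require Import measurable_realfun.
From mathcomp Require Import zify ring lra.
Import Order.TTheory GRing.Theory Num.Theory.
Import numFieldNormedType.Exports.
Local Open Scope classical_set_scope.
Local Open Scope ring_scope.
Set Implicit Arguments. Unset Strict Implicit. Unset Printing Implicit Defensive.

(** Flatness of [K] turns (ii) into exact algebra, without error terms. From a parent to its child,
    the integral over the sibling enters both values with the same coefficient and cancels. What is
    left is N^(k+1) (a - b) minus (left child) or plus (right child) N^k (a + b), where a and b are
    the integrals of g over the two halves of the child. For constant g this vanishes exactly when a
    : b is (1 + 1/N) : (1 - 1/N), respectively the inverse ratio, whence eta = 1/N. With equal
    masses and g = 1, the sum of s * (increment)^2 would be N^-2 at every generation and would not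
    be summable. The Poisson kernel is positive and sees no such cancellation: since omega * s =
    |I|^2, the quantity s * P^2 on the gap of I is at least a fixed multiple of omega(I), which adds
    up to the full mass once per generation. The energy factor stays away from 0 because sigma is
    spread over L^k_j; a point mass would give energy 0 on each gap. *)

(** * Functions homogeneous under a discrete group of dilations *)

Section DiscreteHomogeneity.
Variable R : realType.
Implicit Types (f : R -> R) (a c s x y : R) (k : int) (m n : nat).

Lemma exists_exprz_itv a y : 1 < a -> 0 < y ->
  exists k : int, a ^ k <= y < a ^ (k + 1).
Proof.
move=> a1 y0; have a0 : 0 < a by apply: lt_trans a1.
have la0 : 0 < ln a by rewrite ln_gt0.
exists (Num.floor (ln y / ln a)).
have e (k : int) : ln (a ^ k) = k%:~R * ln a.
  by rewrite -powR_intmul ?ltW// ln_powR.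
have p (k : int) : 0 < a ^ k by exact: exprz_gt0.
rewrite -ler_ln ?posrE// -ltr_ln ?posrE// !e -ler_pdivlMr// -ltr_pdivrMr//.
exact: floor_itv.
Qed.

(** Degree -m and parity (-1)^m are tied together as for x^-m: differentiation raises m by one in
    both, so the n-th derivative of [K] is the case m = n + 1. *)
Definition scale_homogeneous a m f := forall x, x != 0 ->
  f (a * x) = f x / a ^+ m /\ f (- x) = (-1) ^+ m * f x.

Lemma scale_homogeneousN a m f : scale_homogeneous a m f ->
  forall x, x != 0 -> f (- x) = (-1) ^+ m * f x.
Proof. by move=> h x /h[]. Qed.

Lemma scale_homogeneousZ a m f k : 0 < a -> scale_homogeneous a m f ->
  forall x, x != 0 -> f (a ^ k * x) = f x / (a ^ k) ^+ m.
Proof.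
move=> a0 h.
have hn n x : x != 0 -> f (a ^+ n * x) = f x / (a ^+ n) ^+ m.
  elim: n x => [|n IH] x x0; first by rewrite expr0 mul1r expr1n divr1.
  have y0 : a ^+ n * x != 0 by rewrite mulf_neq0// expf_neq0// gt_eqF.
  by rewrite exprS -mulrA (h _ y0).1 IH// exprMn invfM mulrA mulrAC.
case: k => n x x0; first exact: hn.
rewrite NegzE -exprnN.
have y0 : a ^- n.+1 * x != 0.
  by rewrite mulf_neq0// invr_neq0// expf_neq0// gt_eqF.
have := hn n.+1 _ y0; rewrite mulrA divff ?expf_neq0 ?gt_eqF// mul1r => ->.
have -> : (a ^- n.+1) ^+ m = (a ^+ n.+1 ^+ m)^-1 by rewrite exprVn.
by rewrite invrK divfK// !expf_neq0// gt_eqF.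
Qed.

Lemma pos_scale_reduction a s x : 1 < a -> 0 < s -> s ^+ 2 = a -> 0 < x ->
  exists k, s^-1 <= a ^ k * x < s.
Proof.
move=> a1 s0 sa x0; have a0 : 0 < a by apply: lt_trans a1.
have [k /andP[k1 k2]] := exists_exprz_itv a1 (mulr_gt0 x0 s0).
have p : 0 < a ^ k by exact: exprz_gt0.
exists (- k); rewrite -invr_expz; apply/andP; split.
  by rewrite ler_pdivlMl// ler_pdivrMr.
rewrite ltr_pdivrMl// -(ltr_pM2r s0) -mulrA -expr2 sa.
by have -> : a ^ k * a = a ^ (k + 1) by rewrite expfzDr ?gt_eqF// expr1z.
Qed.

(** Serves the dilations y -> a^k y and the reflection y -> -y alike. The relation is only asked
    near x because it is known only away from 0. *)
Lemma scale_homogeneous_is_derive a c f x l : a != 0 -> c != 0 ->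
  (\forall y \near x, f (a * y) = c * f y) ->
  is_derive (a * x) 1 f l -> is_derive x 1 f (a / c * l).
Proof.
move=> a0 c0 fac fl.
have ga : is_derive x 1 (fun y => a * y) a.
  by apply: is_derive_eq; rewrite /GRing.scale/= mulr1.
have fg : is_derive x 1 (f \o (fun y => a * y)) (l * a).
  exact: is_derive1_comp.
have : is_derive x 1 (c^-1 \*: (f \o (fun y => a * y))) (c^-1 * (l * a)).
  exact: is_deriveZ.
move/(near_eq_is_derive (g := f)) => H.
have -> : a / c * l = c^-1 * (l * a) by rewrite mulrC mulrA mulrC.
apply: H; apply: filterS fac => y /= ->.
by rewrite /GRing.scale/= mulKf.
Qed.

Lemma near_neq0 x : x != 0 -> \forall y \near x, y != 0.
Proof. by move=> x0; apply: (@cvgr_neq0 R R R (nbhs x) _ id x) => //; exact: cvg_id. Qed.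

Lemma scale_homogeneous_derive1 a m f : 0 < a ->
  (forall x, x != 0 -> derivable f x 1) ->
  scale_homogeneous a m f -> scale_homogeneous a m.+1 (derive1 f).
Proof.
move=> a0 df h x x0; have aN0 : a != 0 by rewrite gt_eqF.
have dx y : y != 0 -> is_derive y 1 f ((derive1 f) y).
  by move=> y0; rewrite derive1E; apply/derivableP/df.
split.
  have : is_derive x 1 f (a / (a ^- m) * (derive1 f) (a * x)).
    apply: scale_homogeneous_is_derive => //.
    - by rewrite invr_neq0// expf_neq0.
    - by near=> y; rewrite (h y _).1 1?mulrC//; near: y; exact: near_neq0.
    - by apply: dx; rewrite mulf_neq0.
  move=> /@derive_val; rewrite -derive1E => ->.
  by rewrite invrK -exprS [RHS]mulrC mulKf// expf_neq0.
have : is_derive x 1 f (-1 / ((-1) ^+ m) * (derive1 f) (- 1 * x)).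
  apply: scale_homogeneous_is_derive => //.
  - by rewrite expf_neq0// oppr_eq0 oner_neq0.
  - by near=> y; rewrite mulN1r (h y _).2//; near: y; exact: near_neq0.
  - by apply: dx; rewrite mulN1r oppr_eq0.
move=> /@derive_val; rewrite -derive1E => ->.
by rewrite mulN1r invr_sign exprS !mulN1r !mulNr mulrN opprK signrMK.
Unshelve. all: by end_near.
Qed.

Lemma scale_homogeneous_derivable a s m f : 1 < a -> 0 < s -> s ^+ 2 = a ->
  scale_homogeneous a m f ->
  (forall x, s^-1 <= x < s -> derivable f x 1) ->
  forall x, x != 0 -> derivable f x 1.
Proof.
move=> a1 s0 sa h df; have a0 : 0 < a by apply: lt_trans a1.
have pos x : 0 < x -> derivable f x 1.
  move=> x0; have [k kx] := pos_scale_reduction a1 s0 sa x0.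
  have ak0 : a ^ k != 0 by rewrite gt_eqF// exprz_gt0.
  have /derivableP H := df _ kx.
  have [] // := @scale_homogeneous_is_derive (a ^ k) (((a ^ k) ^+ m)^-1) f x _ _ _ _ H => //.
    by rewrite invr_neq0// expf_neq0.
  near=> y; rewrite (@scale_homogeneousZ a m) 1?mulrC//.
  by near: y; apply: near_neq0; rewrite gt_eqF.
move=> x x0; have [xpos|xneg|x00] := ltgtP 0 x; [exact: pos| |
  by rewrite x00 eqxx in x0].
have /derivableP H : derivable f (-1 * x) 1 by apply: pos; rewrite mulN1r oppr_gt0.
have [] // := @scale_homogeneous_is_derive (-1) ((-1) ^+ m) f x _ _ _ _ H => //.
- by rewrite expf_neq0// oppr_eq0 oner_neq0.
- by near=> y; rewrite mulN1r (scale_homogeneousN h)//; near: y; exact: near_neq0.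
Unshelve. all: by end_near.
Qed.

(** Undoing the dilation costs (a^k)^m, and a^k |x| <= s turns this into s^m / |x|^m. *)
Lemma scale_homogeneous_norm_bound a s m f B : 1 < a -> 0 < s -> s ^+ 2 = a ->
  scale_homogeneous a m f -> (forall x, s^-1 <= x <= s -> `|f x| <= B) ->
  forall x, x != 0 -> `|f x| <= B * s ^+ m / `|x| ^+ m.
Proof.
move=> a1 s0 sa h fB; have a0 : 0 < a by apply: lt_trans a1.
have pos x : 0 < x -> `|f x| <= B * s ^+ m / `|x| ^+ m.
  move=> x0; have [k /andP[k1 k2]] := pos_scale_reduction a1 s0 sa x0.
  have ak0 : 0 < a ^ k by rewrite exprz_gt0.
  have := fB (a ^ k * x); rewrite k1 ltW// => /(_ isT).
  rewrite (@scale_homogeneousZ a m)// ?gt_eqF// normrM normfV normrX.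
  rewrite (gtr0_norm ak0) (gtr0_norm x0) ler_pdivrMr ?exprn_gt0// => H.
  rewrite ler_pdivlMr ?exprn_gt0//.
  have B0 : 0 <= B.
    by rewrite -(pmulr_lge0 _ (exprn_gt0 m ak0)); apply: le_trans H.
  apply: (@le_trans _ _ (B * (a ^ k) ^+ m * x ^+ m)).
    by rewrite ler_wpM2r// exprn_ge0// ltW.
  rewrite -mulrA -exprMn ler_wpM2l// lerXn2r ?nnegrE ?(ltW k2) ?(ltW s0)//.
  by rewrite mulr_ge0// ltW.
move=> x x0; have [xpos|xneg|x00] := ltgtP 0 x; [exact: pos| |
  by rewrite x00 eqxx in x0].
rewrite -[in f x](opprK x) (scale_homogeneousN h) ?oppr_eq0//.
by rewrite normrM normrX normrN1 expr1n mul1r -(normrN x) pos// oppr_gt0.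
Qed.

Lemma is_derive_exprV n x : x != 0 ->
  is_derive x 1 (fun y : R => y^-1 ^+ n) (- n%:R * x^-1 ^+ n.+1).
Proof.
move=> x0.
have H : is_derive x 1 (fun y : R => y^-1) (- x^-1 ^+ 2).
  have -> : - x^-1 ^+ 2 = - (x ^- 2) *: (1 : R) by rewrite /GRing.scale/= mulr1 exprVn.
  exact: (@is_deriveV R id x 1 1).
case: n => [|n].
  under eq_fun do rewrite expr0.
  by rewrite oppr0 mul0r; exact: is_derive_cst.
have -> : (fun y : R => y^-1 ^+ n.+1) = (fun y : R => y^-1) ^+ n.+1.
  by apply/funext => y; rewrite exprfctE.
apply: is_derive_eq; rewrite /GRing.scale/=.
by rewrite mulrN mulNr -mulrA -exprD addn2.
Qed.

(** Stated for germs, since equality at one point says nothing about derivatives; it is meant for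
    the junction point of two scaled copies of the kernel. *)
Lemma derive1n_inv_near f x n :
  (\forall y \near x, y != 0 /\ f y = y^-1) ->
  \forall y \near x, y != 0 /\ (derive1n n f) y = (-1) ^+ n * n`!%:R * y^-1 ^+ n.+1.
Proof.
elim: n => [|n IH] h.
  by apply: filterS h => y [y0 fy]; rewrite derive1n0 fy expr0 expr1 !mul1r.
have := IH h => /near_join; apply: filterS => y; move=> hy.
have y0 : y != 0 by apply: (nbhs_singleton hy).1.
split=> //; rewrite derive1nS derive1E.
have -> : 'D_1 (derive1n n f) y = 'D_1 (fun y => (-1) ^+ n * n`!%:R * y^-1 ^+ n.+1) y.
  by apply: near_eq_derive; apply: filterS hy => z [].
have H := is_derive_exprV n.+1 y0.
have : is_derive y 1 (((-1) ^+ n * n`!%:R) \*: (fun y : R => y^-1 ^+ n.+1))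
    ((-1) ^+ n * n`!%:R * (- n.+1%:R * y^-1 ^+ n.+2)).
  exact: is_deriveZ.
move=> /@derive_val ->; rewrite factS natrM !exprS; ring.
Qed.

Lemma derive1n_inv_derivable f x n :
  (\forall y \near x, y != 0 /\ f y = y^-1) -> derivable (derive1n n f) x 1.
Proof.
move=> h; have hn := derive1n_inv_near n h.
have x0 : x != 0 by apply: (nbhs_singleton hn).1.
have H := is_derive_exprV n.+1 x0.
have : is_derive x 1 (((-1) ^+ n * n`!%:R) \*: (fun y : R => y^-1 ^+ n.+1))
    ((-1) ^+ n * n`!%:R * (- n.+1%:R * x^-1 ^+ n.+2)).
  exact: is_deriveZ.
move=> /@ex_derive; apply: near_eq_derivable.
by apply: filterS hn => y [_ ->].
Qed.

End DiscreteHomogeneity.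

(** * The flattened kernel: smoothness, size, Calderon-Zygmund estimates *)

Section FlatKernel.
Variables (R : realType) (N : nat) (rho : R) (K : R -> R).
Hypotheses (N16 : (16 <= N)%N) (rho_itv : 2 / 3 <= rho < 1)
  (KE : Kflat_spec N rho K).
Local Notation a := (N%:R : R).
Local Notation s := (Num.sqrt a).

Let a16 : 16 <= a.
Proof. by rewrite ler_nat. Qed.

Let a_gt0 : 0 < a.
Proof. by apply: lt_le_trans a16. Qed.

Let a_gt1 : 1 < a.
Proof. by apply: lt_le_trans a16; rewrite ltr1n. Qed.

Let s2 : s ^+ 2 = a.
Proof. by rewrite sqr_sqrtr// ltW. Qed.

Let s_ge4 : 4 <= s.
Proof.
have -> : 4 = Num.sqrt (4 ^+ 2 : R) by rewrite sqrtr_sqr ger0_norm.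
by rewrite ler_wsqrtr// -natrX.
Qed.

Let s_gt0 : 0 < s.
Proof. by apply: lt_le_trans s_ge4. Qed.

Let rho_gt0 : 0 < rho.
Proof. by case/andP: rho_itv => + _; apply: lt_le_trans; rewrite divr_gt0. Qed.

Lemma Kflat_homogeneous : scale_homogeneous a 1 K.
Proof.
have [_ [_ [_ [_ [_ [_ [Ks Kodd]]]]]]] := KE.
have pos x : 0 < x -> K (a * x) = K x / a.
  move=> x0; have [k /andP[k1 k2]] := pos_scale_reduction a_gt1 s_gt0 s2 x0.
  have ap (l : int) : 0 < a ^ l by exact: exprz_gt0.
  (* Both x and a x are scaled copies of one point of the fundamental period, so two instances of
     the scaling clause compare their values. *)
  have akx : x = a ^ (- k) * (a ^ k * x).
    by rewrite mulrA -expfzDr ?gt_eqF// addNr expr0z mul1r.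
  have ax : a * x = a ^ (1 - k) * (a ^ k * x).
    by rewrite mulrA -expfzDr ?gt_eqF// subrK expr1z.
  have E (l : int) : K (a ^ l * (a ^ k * x)) = a ^ (- l) * K (a ^ k * x).
    rewrite (Ks l); last first.
      by rewrite ler_wpM2l ?(ltW (ap _))//= ler_wpM2l ?(ltW (ap _))// ltW.
    by congr (_ * K _); rewrite mulrA -expfzDr ?gt_eqF// addNr expr0z mul1r.
  have E0 : K x = a ^ k * K (a ^ k * x) by rewrite {1}akx E opprK.
  by rewrite ax E E0 opprB mulrAC expfzDr ?gt_eqF.
move=> x x0; rewrite !expr1 mulN1r; split; last exact: Kodd.
have [xpos|xneg|x00] := ltgtP 0 x; [exact: pos| |
  by rewrite x00 eqxx in x0].
have := pos (- x); rewrite oppr_gt0 => /(_ xneg).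
have ax0 : a * x != 0 by rewrite mulf_neq0// gt_eqF.
by rewrite mulrN (Kodd _ x0) (Kodd _ ax0) mulNr => /oppr_inj.
Qed.

(* K = 1/x on both sides of the junction point s^-1 of two scaled copies, so that
   smoothness inside one period gives smoothness everywhere. *)
Lemma Kflat_near_inv : \forall y \near s^-1, y != 0 /\ K y = y^-1.
Proof.
have [_ [_ [_ [Kl [Kr _]]]]] := KE.
set t := Num.sqrt (rho * a) in Kl Kr.
have t0 : 0 < t by rewrite sqrtr_gt0 mulr_gt0.
have ts : t < s.
  rewrite ltr_sqrt ?mulr_gt0// -[ltRHS]mul1r ltr_pM2r//.
  by case/andP: rho_itv.
have ta : t / a < s^-1 by rewrite ltr_pdivrMr// -[X in _ * X]s2 expr2 mulKf ?gt_eqF.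
have st : s^-1 < t^-1 by rewrite ltf_pV2// posrE.
have := near_in_itvoo (a := t / a) (b := t^-1) (x := s^-1).
rewrite in_itv/= ta st => /(_ isT); apply: filterS => y.
rewrite in_itv/= => /andP[y1 y2].
have y0 : 0 < y by apply: le_lt_trans y1; rewrite ltW// divr_gt0.
split; first by rewrite gt_eqF.
have [sy|ys] := leP s^-1 y; first by rewrite Kl// sy ltW.
have := (Kflat_homogeneous (negbT (gt_eqF y0))).1.
rewrite expr1 Kr; last first.
  rewrite -ler_pdivrMl// mulrC (ltW y1)/=.
  by rewrite -ler_pdivlMl// -[X in X^-1]s2 expr2 invfM mulfVK ?gt_eqF// ltW.
move=> /(congr1 ( *%R^~ a)); rewrite /= divfK ?gt_eqF// => <-.
by rewrite invfM mulrC mulVKf ?gt_eqF.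
Qed.

(** A joint induction: homogeneity spreads differentiability from one period to the line, and
    differentiability is what allows the homogeneity relation to be differentiated. Inside the open
    period it is given; the endpoint s^-1 is the junction point. *)
Let Kflat_homogeneous_derivable n :
  scale_homogeneous a n.+1 (derive1n n K) /\
  forall x, x != 0 -> derivable (derive1n n K) x 1.
Proof.
have [Kd _] := KE.
have step m : scale_homogeneous a m.+1 (derive1n m K) ->
    forall x, x != 0 -> derivable (derive1n m K) x 1.
  move=> h; apply: (scale_homogeneous_derivable a_gt1 s_gt0 s2 h) => x.
  rewrite le_eqVlt => /andP[/predU1P[<- _|sx xs]].
    exact: derive1n_inv_derivable Kflat_near_inv.
  by apply: Kd; rewrite sx.
elim: n => [|n [h hd]].
  by split; [|apply: step]; exact: Kflat_homogeneous.
have h' : scale_homogeneous a n.+2 (derive1n n.+1 K).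
  by rewrite derive1nS; exact: scale_homogeneous_derive1.
by split=> //; exact: step.
Qed.

Lemma Kflat_derivable n x : x != 0 -> derivable (derive1n n K) x 1.
Proof. exact: (@Kflat_homogeneous_derivable n).2. Qed.

Lemma Kflat_norm_bound n :
  exists2 C, 0 < C & forall x, x != 0 -> `|derive1n n K x| <= C / `|x| ^+ n.+1.
Proof.
set f := derive1n n K.
have s1 : s^-1 <= s.
  have h : 1 <= s by apply: le_trans s_ge4; rewrite ler1n.
  by rewrite (le_trans _ h)// invf_le1.
have fc : {within `[s^-1, s], continuous (fun x => `|f x|)}.
  apply: continuous_in_subspaceT => x; rewrite inE/= in_itv/= => /andP[sx _].
  have x0 : x != 0 by rewrite gt_eqF// (lt_le_trans _ sx)// invr_gt0.
  apply: continuous_comp; last exact: norm_continuous.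
  exact/differentiable_continuous/derivable1_diffP/Kflat_derivable.
have [c _ cB] := EVT_max s1 fc.
have [h _] := @Kflat_homogeneous_derivable n.
have H := @scale_homogeneous_norm_bound R a s n.+1 f `|f c| a_gt1 s_gt0 s2 h.
(* The maximum could be 0; the [+ 1] keeps the constant positive. *)
exists (`|f c| * s ^+ n.+1 + 1); first by rewrite ltr_wpDl// mulr_ge0// exprn_ge0// ltW.
move=> x x0; apply: (le_trans (H _ x x0)) => [y ys|]; first by apply: cB; rewrite in_itv.
by rewrite ler_wpM2r ?invr_ge0 ?exprn_ge0// lerDl.
Qed.

Lemma Kflat_elliptic : exists c C : R, 0 < c /\ c <= C /\
  forall x : R, x != 0 -> c / `|x| <= `|K x| <= C / `|x|.
Proof.
have [_ [_ [Kb _]]] := KE.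
have h := Kflat_homogeneous.
(* On the fundamental period x and K(x) both lie in [s^-1, s], so x K(x), which is invariant under
   the dilations, lies in [1/a, a]. *)
exists a^-1, a; split; first by rewrite invr_gt0.
split; first by rewrite (@le_trans _ _ 1)// ?invf_le1// ltW.
move=> x x0; apply/andP; split; last first.
  have := @scale_homogeneous_norm_bound R a s 1 K s a_gt1 s_gt0 s2 h.
  rewrite !expr1 -expr2 s2; apply=> // y ys.
  by have /andP[+ +] := Kb _ ys => k1 k2; rewrite gtr0_norm// (lt_le_trans _ k1)// invr_gt0.
have Kge y : s^-1 <= y <= s -> s^-1 <= `|K y|.
  by move=> /Kb/andP[k1 _]; rewrite (le_trans k1)// ler_norm.
have pos y : 0 < y -> a^-1 / `|y| <= `|K y|.
  move=> y0; have [k /andP[k1 k2]] := pos_scale_reduction a_gt1 s_gt0 s2 y0.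
  have ak0 : 0 < a ^ k by rewrite exprz_gt0.
  have := Kge (a ^ k * y); rewrite k1 ltW// => /(_ isT).
  rewrite (scale_homogeneousZ _ _ h) ?gt_eqF// expr1 normrM normfV (gtr0_norm ak0).
  rewrite (gtr0_norm y0) ler_pdivlMr// => H.
  apply: le_trans H; rewrite ler_pdivrMr// -mulrA -[X in X^-1]s2 expr2 invfM.
  by rewrite ler_pM2l ?invr_gt0.
have [xpos|xneg|x00] := ltgtP 0 x; [exact: pos| |by rewrite x00 eqxx in x0].
have := pos (- x); rewrite oppr_gt0 => /(_ xneg).
by rewrite (scale_homogeneousN h)// normrM expr1 normrN1 mul1r normrN.
Qed.

(* [3/8, 8/3] lies in the plateau of K as soon as N >= 16 and rho >= 2/3. *)
Lemma Kflat_one_scaled (k : nat) x : 3 / 8 <= a ^+ k * x <= 8 / 3 -> K x = a ^+ k.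
Proof.
have [_ [_ [_ [_ [_ [K1 _]]]]]] := KE.
set t := Num.sqrt (rho ^+ 2 * a) in K1.
have tE : t = rho * s by rewrite /t sqrtrM ?sqr_ge0// sqrtr_sqr gtr0_norm.
have t83 : 8 / 3 <= t.
  have /andP[r _] := rho_itv.
  have -> : 8 / 3 = 2 / 3 * 4 :> R by field.
  by rewrite tE ler_pM// divr_ge0.
have t38 : t^-1 <= 3 / 8.
  by rewrite -[leRHS]invrK invf_div lef_pV2 ?posrE// ?(lt_le_trans _ t83)// divr_gt0.
move=> /andP[x1 x2].
have ak0 : 0 < a ^ k by rewrite exprz_gt0.
have ax0 : 0 < a ^+ k * x by rewrite (lt_le_trans _ x1)// divr_gt0.
have x0 : x != 0 by move: ax0; rewrite pmulr_rgt0// => h; rewrite gt_eqF.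
have := scale_homogeneousZ (k : int) a_gt0 Kflat_homogeneous x0.
rewrite expr1 K1; last by rewrite (le_trans t38)//= (le_trans x2).
by move/esym/divr1_eq => ->.
Qed.

Lemma Kflat_measurable : measurable_fun setT K.
Proof.
(* The value of [K] at 0 is arbitrary, hence the separate singleton. *)
have -> : [set: R] = [set 0] `|` [set~ 0] by rewrite setUv.
apply/measurable_funU => //; first exact: measurableC.
split; first by apply: measurable_fun_set1.
apply: open_continuous_measurable_fun.
  by apply: closed_openC; exact: closed_eq.
move=> x; rewrite inE/= => /eqP x0.
exact/differentiable_continuous/derivable1_diffP/(@Kflat_derivable 0).
Qed.

Let is_diff_sub (p : R * R) :
  is_diff p (fun q : R * R => q.1 - q.2) (fun q : R * R => q.1 - q.2).
Proof.
pose d (q : R * R) : R := q.1 - q.2.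
have lin_d : linear d.
  by move=> c u v; rewrite /d /= scalerBr opprD addrACA.
pose dl := HB.pack_for {linear (R * R)%type -> R} d (GRing.isLinear.Build _ _ _ _ _ lin_d).
have dc : continuous dl.
  by move=> q; apply: cvgB; [exact: cvg_fst|exact: cvg_snd].
apply: DiffDef; first exact: (linear_differentiable (f := dl)).
exact: (diff_lin (f := dl)).
Qed.

Let is_diff_K (x y : R) : x != y ->
  is_diff (x, y) (fun p : R * R => K (p.1 - p.2))
    (fun q : R * R => (q.1 - q.2) * derive1 K (x - y)).
Proof.
move=> xy; have d0 : x - y != 0 by rewrite subr_eq0.
have dK : is_diff (x - y) K (fun h => h *: derive1 K (x - y)).
  have H : differentiable K (x - y) by apply/derivable1_diffP/(@Kflat_derivable 0).
  by apply: DiffDef => //; exact: diff1E.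
exact: is_diff_comp (is_diff_sub (x, y)) dK.
Qed.

Let grad_normE (F : R * R -> R) p (u v : R) :
  'd F p (1, 0) = u -> 'd F p (0, 1) = v ->
  grad_norm F p = Num.sqrt (u ^+ 2 + v ^+ 2).
Proof. by move=> <- <-. Qed.

Let grad_distE (F : R * R -> R) p q (u v u' v' : R) :
  'd F p (1, 0) = u -> 'd F p (0, 1) = v ->
  'd F q (1, 0) = u' -> 'd F q (0, 1) = v' ->
  grad_dist F p q = Num.sqrt ((u - u') ^+ 2 + (v - v') ^+ 2).
Proof. by move=> <- <- <- <-. Qed.

Let sqrt2sq (u : R) : Num.sqrt (u ^+ 2 + (- u) ^+ 2) = Num.sqrt 2 * `|u|.
Proof. 
have -> : u ^+ 2 + (- u) ^+ 2 = 2 * u ^+ 2 by rewrite sqrrN mulr_natl mulr2n.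
by rewrite sqrtrM// sqrtr_sqr. Qed.

(** Mean value theorem: the segment from u to v stays at distance at least |u| / 2 from the
    singularity, and the cubic decay of the second derivative gives 8 = 2^3. *)
Lemma Kflat_derive1_lipschitz : exists2 C, 0 < C & forall u v : R, u != 0 ->
  `|u - v| <= `|u| / 2 ->
  `|derive1 K u - derive1 K v| <= C * `|u - v| / `|u| ^+ 3.
Proof.
have [C C0 HC] := Kflat_norm_bound 2.
exists (C * 8); first by rewrite mulr_gt0.
have main (u v p q : R) : u != 0 -> `|u - v| <= `|u| / 2 -> p < q ->
    (p = u /\ q = v \/ p = v /\ q = u) ->
    `|derive1 K q - derive1 K p| <= C * 8 * `|u - v| / `|u| ^+ 3.
  move=> u0 uv pq pqE.
  have far c : p <= c <= q -> `|u| / 2 <= `|c|.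
    move=> /andP[pc cq].
    suff cu : `|u - c| <= `|u| / 2.
      have : `|u| <= `|u - c| + `|c| by rewrite -{1}(subrK c u) ler_normD.
      by move: cu; lra.
    apply: le_trans uv.
    case: pqE => -[pE qE]; move: pc cq; rewrite pE qE => pc cq.
      by rewrite distrC (distrC u) !ger0_norm ?subr_ge0// ?lerD2r// (le_trans pc).
    by rewrite !ger0_norm ?subr_ge0// ?lerB// (le_trans pc).
  have u20 : 0 < `|u| / 2 by rewrite divr_gt0 ?normr_gt0.
  have nz c : p <= c <= q -> c != 0.
    by move=> /far h; rewrite -normr_gt0 (lt_le_trans _ h).
  have dK c : p <= c <= q -> is_derive c 1 (derive1 K) (derive1n 2 K c).
    move=> /nz c0; rewrite derive1nS derive1E; apply/derivableP.
    exact: (@Kflat_derivable 1).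
  have [c cpq ->] : exists2 c, c \in `]p, q[%R &
      derive1 K q - derive1 K p = derive1n 2 K c * (q - p).
    apply: (@MVT R (derive1 K) (derive1n 2 K) p q pq).
      by move=> c; rewrite in_itv/= => /andP[h1 h2]; apply: dK; rewrite !ltW.
    apply: continuous_in_subspaceT => c; rewrite inE/= in_itv/= => h.
    exact/differentiable_continuous/derivable1_diffP/(@Kflat_derivable 1)/nz.
  have cpq' : p <= c <= q by move: cpq; rewrite in_itv/= => /andP[h1 h2]; rewrite !ltW.
  rewrite normrM.
  have -> : `|q - p| = `|u - v| by case: pqE => -[-> ->]//; rewrite distrC.
  rewrite mulrAC ler_wpM2r//.
  apply: (le_trans (HC _ (nz _ cpq'))); rewrite -mulrA ler_pM2l//.
  rewrite -[leRHS]invrK lef_pV2 ?posrE ?exprn_gt0 ?normr_gt0 ?(nz _ cpq')//; last first.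
    by rewrite invr_gt0 mulr_gt0 ?invr_gt0 ?exprn_gt0 ?normr_gt0.
  rewrite invfM invrK.
  have -> : 8^-1 * `|u| ^+ 3 = (`|u| / 2) ^+ 3 by field.
  by rewrite lerXn2r ?nnegrE// ?far// ltW.
move=> u v u0 uv; have [uv'|vu|<-] := ltgtP u v.
- by rewrite distrC (main u v u v)//; left.
- by rewrite (main u v v u)//; right.
- by rewrite !subrr !normr0 mulr0 mul0r.
Qed.

(** The gradient of K(x - y) is (K', -K'), whence the factors sqrt 2; the Lipschitz bound gives
    delta = 1. Moving x or y only changes x - y, so the estimate [gd] serves both variables. *)
Lemma Kflat_std_CZ : std_CZ_kernel (fun x y : R => K (x - y)).
Proof.
have [C0 C00 H0] := Kflat_norm_bound 0.
have [C1 C10 H1] := Kflat_norm_bound 1.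
have [C2 C20 H2] := Kflat_derive1_lipschitz.
have r2 : 0 < Num.sqrt 2 :> R by rewrite sqrtr_gt0.
pose C := C0 + Num.sqrt 2 * C1 + Num.sqrt 2 * C2.
have rC1 : 0 < Num.sqrt 2 * C1 by rewrite mulr_gt0.
have rC2 : 0 < Num.sqrt 2 * C2 by rewrite mulr_gt0.
have dE x y : x != y ->
    ('d (fun p : R * R => K (p.1 - p.2)) (x, y) (1, 0) = derive1 K (x - y)) *
    ('d (fun p : R * R => K (p.1 - p.2)) (x, y) (0, 1) = - derive1 K (x - y)).
  move=> xy; have := is_diff_K xy => H; rewrite diff_val /= ; split.
    by rewrite subr0 mul1r.
  by rewrite sub0r mulN1r.
have gdE x y x' y' : x != y -> x' != y' ->
    grad_dist (fun p : R * R => K (p.1 - p.2)) (x, y) (x', y') =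
    Num.sqrt 2 * `|derive1 K (x - y) - derive1 K (x' - y')|.
  move=> xy xy'.
  have [[p1 p2] [q1 q2]] := (dE _ _ xy, dE _ _ xy').
  rewrite (grad_distE p1 p2 q1 q2) -sqrt2sq; congr (Num.sqrt (_ + _ ^+ 2)).
  by rewrite opprB opprK addrC.
have gd x y x' y' : x != y -> `|x - y - (x' - y')| <= `|x - y| / 2 ->
    grad_dist (fun p : R * R => K (p.1 - p.2)) (x, y) (x', y') <=
    C * (`|x - y - (x' - y')| / `|x - y|) `^ 1 / `|x - y| ^+ 2.
  move=> xy h.
  have xy0 : x - y != 0 by rewrite subr_eq0.
  have nxy : 0 < `|x - y| by rewrite normr_gt0.
  (* If x' = y', the hypothesis would read |x - y| <= |x - y| / 2. *)
  have xy' : x' != y'.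
    apply/eqP => xy'; move: h; rewrite xy' subrr subr0.
    by move: nxy; lra.
  rewrite gdE// powRr1 ?divr_ge0//.
  apply: (@le_trans _ _ (Num.sqrt 2 * (C2 * `|x - y - (x' - y')| / `|x - y| ^+ 3))).
    by rewrite ler_pM2l// H2.
  rewrite [leLHS](_ : _ = Num.sqrt 2 * C2 * (`|x - y - (x' - y')| / `|x - y|) / `|x - y| ^+ 2).
    rewrite ler_wpM2r ?invr_ge0 ?exprn_ge0// ler_wpM2r ?divr_ge0//.
    by rewrite /C; lra.
  by field; rewrite normr_eq0.
exists C, 1; split; first by rewrite /C; lra.
split=> // x y xy.
have xy0 : x - y != 0 by rewrite subr_eq0.
split; first by have [] := is_diff_K xy.
split.
  apply: (le_trans (H0 _ xy0)); rewrite expr1 ler_wpM2r ?invr_ge0//.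
  by rewrite /C; lra.
split.
  have [p1 p2] := dE _ _ xy; rewrite (grad_normE p1 p2) sqrt2sq.
  apply: (@le_trans _ _ (Num.sqrt 2 * (C1 / `|x - y| ^+ 2))).
    by rewrite ler_pM2l// H1.
  rewrite mulrA ler_wpM2r ?invr_ge0 ?exprn_ge0//.
  by rewrite /C; lra.
split=> z hz.
  have e : x - y - (z - y) = x - z by ring.
  by have := @gd x y z y xy; rewrite e; exact.
have e : x - y - (x - z) = z - y by ring.
by have := @gd x y x z xy; rewrite e (distrC z); exact.
Qed.

End FlatKernel.

(** * Geometry of the Cantor intervals, their gaps and central intervals *)

Section CantorGeometry.
Variables (R : realType) (N : nat).
Hypothesis N16 : (16 <= N)%N.
Local Notation ell k := (Npow R N k).
Local Notation left := (cantor_left R N).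
Local Notation I := (@cantor_int R N).
Implicit Types (k j m i : nat) (x y : R).

Let a16 : 16 <= N%:R :> R.
Proof. by rewrite ler_nat. Qed.

Lemma Npow_gt0 k : 0 < ell k.
Proof. by rewrite invr_gt0 exprn_gt0// (lt_le_trans _ a16). Qed.

Lemma NpowS k : ell k = N%:R * ell k.+1.
Proof.
by rewrite /Npow exprS invfM mulVKf// gt_eqF// (lt_le_trans _ a16).
Qed.

Lemma Npow0 : ell 0 = 1.
Proof. by rewrite /Npow expr0 invr1. Qed.

Lemma mulr_Npow k : N%:R ^+ k * ell k = 1.
Proof. by rewrite divff// expf_neq0// gt_eqF// (lt_le_trans _ a16). Qed.

Lemma NpowS_le k : 16 * ell k.+1 <= ell k.
Proof. by rewrite (NpowS k) ler_pM2r ?Npow_gt0. Qed.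

Lemma cantor_left_even k j : left k.+1 j.*2 = left k j.
Proof. by rewrite /= doubleK odd_double addr0. Qed.

Lemma cantor_left_odd k j : left k.+1 j.*2.+1 = left k j + (ell k - ell k.+1).
Proof. by rewrite /= uphalf_double odd_double. Qed.

Lemma cantor_left_half k j :
  left k j./2 <= left k.+1 j <= left k j./2 + (ell k - ell k.+1).
Proof.
have := NpowS_le k; have := Npow_gt0 k.+1; rewrite [left k.+1 j]/=.
by case: odd => ? ?; apply/andP; lra.
Qed.

(** Siblings are the extreme case: their left endpoints differ by N^-(k-1) - N^-k = (N - 1) N^-k.
    Distinct parents are separated on a scale N times larger, which dwarfs the shift inside a
    parent. *)
Lemma cantor_left_separated k j j' : (j < j')%N -> (j' < 2 ^ k)%N ->
  left k j + (N%:R - 1) * ell k <= left k j'.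
Proof.
elim: k j j' => [|k IH] j j' jj' j'k.
  by move: j'k; rewrite expn0; case: j' jj'.
have j'k' : (j'./2 < 2 ^ k)%N by rewrite ltn_half_double -mul2n -expnS.
have := half_leq (ltnW jj'); rewrite leq_eqVlt => /predU1P[hE|hlt].
  have oE := odd_double_half j; have o'E := odd_double_half j'.
  have [oj oj'] : odd j = false /\ odd j' = true.
    by case: (odd j) (odd j') oE o'E => -[]; rewrite hE; lia.
  by rewrite /= oj oj' hE (NpowS k); lra.
have := IH _ _ hlt j'k'.
have /andP[_ h1] := cantor_left_half k j; have /andP[h2 _] := cantor_left_half k j'.
have := NpowS_le k; have := Npow_gt0 k.+1.
move=> e0 e1 h; apply: le_trans h2; apply: le_trans h; rewrite -lerBrDr.
apply: le_trans h1 _; rewrite -addrA lerD2l.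
have e3 : N%:R * ell k.+1 = ell k by rewrite -NpowS.
have e2 : 16 * ell k <= N%:R * ell k by rewrite ler_pM2r ?Npow_gt0.
by lra.
Qed.

Lemma cantor_intP k j x : I k j x <-> left k j <= x <= left k j + ell k.
Proof. by rewrite /cantor_int/= in_itv. Qed.

Lemma measurable_cantor_int k j : measurable (I k j).
Proof. exact: measurable_itv. Qed.

Lemma cantor_int_half k j : I k.+1 j `<=` I k j./2.
Proof.
move=> x /cantor_intP/andP[x1 x2]; apply/cantor_intP.
have /andP[h1 h2] := cantor_left_half k j.
by apply/andP; lra.
Qed.

Lemma cantor_int_left k j : I k.+1 j.*2 `<=` I k j.
Proof. by have := @cantor_int_half k j.*2; rewrite doubleK. Qed.

Lemma cantor_int_right k j : I k.+1 j.*2.+1 `<=` I k j.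
Proof. by have := @cantor_int_half k j.*2.+1; rewrite /= uphalf_double. Qed.

Lemma cantor_int_inj k j j' x : (j < 2 ^ k)%N -> (j' < 2 ^ k)%N ->
  I k j x -> I k j' x -> j = j'.
Proof.
have main i i' : (i < i')%N -> (i' < 2 ^ k)%N -> I k i x -> I k i' x -> False.
  move=> ii' i'k /cantor_intP/andP[_ x1] /cantor_intP/andP[x2 _].
  have := cantor_left_separated ii' i'k.
  have e0 := Npow_gt0 k; have e2 : 16 * ell k <= N%:R * ell k by rewrite ler_pM2r.
  by lra.
move=> jk j'k xj xj'; have [jj'|j'j|//] := ltngtP j j'.
- by case: (main _ _ jj' j'k xj xj').
- by case: (main _ _ j'j jk xj' xj).
Qed.

Lemma cantor_children_disjoint k j : I k.+1 j.*2 `&` I k.+1 j.*2.+1 = set0.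
Proof.
apply/seteqP; split=> // x [/cantor_intP + /cantor_intP].
rewrite cantor_left_even cantor_left_odd => /andP[_ h1] /andP[h2 _].
by have := NpowS_le k; have := Npow_gt0 k.+1; move=> ? ?; exfalso; lra.
Qed.

Definition gap k j : set R :=
  `]left k j + ell k.+1, left k j + ell k - ell k.+1[%classic.

Lemma gapP k j x :
  gap k j x <-> left k j + ell k.+1 < x < left k j + ell k - ell k.+1.
Proof. by rewrite /gap/= in_itv. Qed.

Lemma measurable_gap k j : measurable (gap k j).
Proof. exact: measurable_itv. Qed.

Lemma gap_sub k j : gap k j `<=` I k j.
Proof.
move=> x /gapP/andP[h1 h2]; apply/cantor_intP; have := Npow_gt0 k.+1.
by move=> ?; apply/andP; lra.
Qed.

Lemma Lint_gap k j : Lint N k j `<=` gap k j.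
Proof.
move=> x; rewrite /Lint/= in_itv/= /cantor_center => /andP[h1 h2]; apply/gapP.
by have := NpowS_le k; have := Npow_gt0 k.+1; move=> ? ?; apply/andP; lra.
Qed.

Lemma measurable_Lint k j : measurable (@Lint R N k j).
Proof. exact: measurable_itv. Qed.

Lemma cantor_int_decomp k j :
  I k j = gap k j `|` (I k.+1 j.*2 `|` I k.+1 j.*2.+1).
Proof.
have e0 := Npow_gt0 k.+1; have e1 := NpowS_le k.
apply/seteqP; split=> [x /cantor_intP/andP[h1 h2]|x [/gap_sub//|[|]]]; last 2 first.
- exact: cantor_int_left.
- exact: cantor_int_right.
have [h3|h3] := leP x (left k j + ell k.+1).
  by right; left; apply/cantor_intP; rewrite cantor_left_even h1.
have [h4|h4] := ltP x (left k j + ell k - ell k.+1).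
  by left; apply/gapP; rewrite h3.
by right; right; apply/cantor_intP; rewrite cantor_left_odd; apply/andP; lra.
Qed.

Lemma gap_disjoint_int k j m i x : (j < 2 ^ k)%N -> (i < 2 ^ m)%N -> (k < m)%N ->
  gap k j x -> ~ I m i x.
Proof.
move=> jk + + gx; elim: m i => // m IH i im; rewrite ltnS leq_eqVlt => /predU1P[km|km].
  subst m; have ik : (i./2 < 2 ^ k)%N by rewrite ltn_half_double -mul2n -expnS.
  move=> ix; have ij := cantor_int_inj jk ik (gap_sub gx) (cantor_int_half ix).
  move: ix => /cantor_intP; move: gx => /gapP/andP[g1 g2].
  rewrite -(odd_double_half i) -ij; case: odd; rewrite ?add1n ?add0n.
    rewrite cantor_left_odd => /andP[h1 _].
    by move: h1; rewrite addrA leNgt g2.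
  rewrite cantor_left_even => /andP[_ h1].
  by have := lt_le_trans g1 h1; rewrite ltxx.
move=> /cantor_int_half; apply: IH => //.
by rewrite ltn_half_double -mul2n -expnS.
Qed.

(** Each central interval sits in its own gap, and gaps of all generations are pairwise disjoint.
    Hence only one term of the double series defining sigma survives inside a gap. *)
Lemma gap_Lint_inj k j m i x : (j < 2 ^ k)%N -> (i < 2 ^ m)%N ->
  gap k j x -> Lint N m i x -> k = m /\ j = i.
Proof.
move=> jk im gx lx; have lx' := Lint_gap lx; have [km|mk|km] := ltngtP k m.
- by case: (gap_disjoint_int jk im km gx (gap_sub lx')).
- by case: (gap_disjoint_int im jk mk lx' (gap_sub gx)).
- by subst m; split=> //; exact: cantor_int_inj jk im (gap_sub gx) (gap_sub lx').
Qed.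

Let scale_dist k x : 3 / 8 * ell k <= x <= 8 / 3 * ell k ->
  3 / 8 <= N%:R ^+ k * x <= 8 / 3.
Proof.
have e := Npow_gt0 k.
have {1 2}-> : x = N%:R ^+ k * x * ell k by rewrite mulrAC mulr_Npow mul1r.
by rewrite !(ler_pM2r e).
Qed.

Lemma sibling_dist k j x y : I k.+1 j.*2 x -> I k.+1 j.*2.+1 y ->
  3 / 8 <= N%:R ^+ k * (y - x) <= 8 / 3.
Proof.
move=> /cantor_intP + /cantor_intP; rewrite cantor_left_even cantor_left_odd.
move=> /andP[x1 x2] /andP[y1 y2].
have e0 := Npow_gt0 k.+1; have e1 := NpowS_le k; have e := Npow_gt0 k.
by apply: scale_dist; apply/andP; lra.
Qed.

(** The critical distance: normalized, it is at least 1/2 - 2/N, which is exactly 3/8 for N = 16.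
    Siblings are farther apart, at least 1 - 2/N. *)
Lemma Lint_left_dist k j x y : Lint N k j y -> I k.+1 j.*2 x ->
  3 / 8 <= N%:R ^+ k * (y - x) <= 8 / 3.
Proof.
rewrite /Lint/= in_itv/= /cantor_center => /andP[y1 y2] /cantor_intP.
rewrite cantor_left_even => /andP[x1 x2].
have e0 := Npow_gt0 k.+1; have e1 := NpowS_le k; have e := Npow_gt0 k.
by apply: scale_dist; apply/andP; lra.
Qed.

Lemma Lint_right_dist k j x y : Lint N k j y -> I k.+1 j.*2.+1 x ->
  3 / 8 <= N%:R ^+ k * (x - y) <= 8 / 3.
Proof.
rewrite /Lint/= in_itv/= /cantor_center => /andP[y1 y2] /cantor_intP.
rewrite cantor_left_odd => /andP[x1 x2].
have e0 := Npow_gt0 k.+1; have e1 := NpowS_le k; have e := Npow_gt0 k.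
by apply: scale_dist; apply/andP; lra.
Qed.

End CantorGeometry.

(** * Weighted square sums on the dyadic tree *)

Lemma sum_nat_double (V : nmodType) (F : nat -> V) n :
  \sum_(0 <= j < n.*2) F j = \sum_(0 <= j < n) (F j.*2 + F j.*2.+1).
Proof.
elim: n => [|n IH]; first by rewrite !big_geq.
by rewrite doubleS !big_nat_recr//= IH addrA.
Qed.

Lemma sum_nat_dyadicS (V : nmodType) (F : nat -> V) k :
  \sum_(0 <= j < 2 ^ k.+1) F j = \sum_(0 <= j < 2 ^ k) (F j.*2 + F j.*2.+1).
Proof. by rewrite expnS mul2n sum_nat_double. Qed.

Section DyadicMartingale.
Variables (R : realType) (N : nat) (w mu : nat -> nat -> R).
Hypothesis N16 : (16 <= N)%N.
Local Notation eta := ((N%:R : R)^-1).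
Hypothesis w_gt0 : forall k j, (j < 2 ^ k)%N -> 0 < w k j.
Hypothesis w00 : w 0 0 = 1.
Hypotheses (w10 : w 1 0 = 1 / 2) (w11 : w 1 1 = 1 / 2).
Hypothesis w_even : forall k j, (1 <= k)%N -> (j < 2 ^ k)%N ->
  w k.+1 j.*2 = (if odd j then 1 - eta else 1 + eta) / 2 * w k j.
Hypothesis w_odd : forall k j, (1 <= k)%N -> (j < 2 ^ k)%N ->
  w k.+1 j.*2.+1 = (if odd j then 1 + eta else 1 - eta) / 2 * w k j.
Hypothesis mu_add : forall k j, (j < 2 ^ k)%N ->
  mu k j = mu k.+1 j.*2 + mu k.+1 j.*2.+1.

(* [outer_value k j] is the value on I^k_j of the transform of the part of the
   measure outside I^k_j: the sibling of each ancestor acts by a constant. *)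
Fixpoint outer_value k j : R :=
  if k is k'.+1 then
    outer_value k' j./2 +
    (if odd j then N%:R ^+ k' * mu k j.-1 else - (N%:R ^+ k' * mu k j.+1))
  else 0.

(** The kernel is odd: the left child lies to the left of L^k_j and counts positively, the right
    child negatively, both at the plateau height N^k. *)
Definition tree_value k j :=
  outer_value k j + N%:R ^+ k * (mu k.+1 j.*2 - mu k.+1 j.*2.+1).

Local Notation s k j := (Npow R N k ^+ 2 / w k j).

Let eta_itv : 0 < eta <= 1 / 16.
Proof.
rewrite invr_gt0 ltr0n (leq_trans _ N16)//=.
by rewrite div1r lef_pV2 ?posrE ?ltr0n ?(leq_trans _ N16)// ler_nat.
Qed.

Let jump k j := tree_value k.+1 j - tree_value k j./2.

(* The weights are tuned so that the increment of [tree_value] is a martingale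
   difference for [w]. *)
Let jump_bound k j : (j < 2 ^ k.+1)%N ->
  s k.+1 j * jump k j ^+ 2 <=
    mu k.+2 j.*2 ^+ 2 / w k.+2 j.*2 + mu k.+2 j.*2.+1 ^+ 2 / w k.+2 j.*2.+1
    - mu k.+1 j ^+ 2 / w k.+1 j.
Proof.
move=> jk; have w0 := w_gt0 jk; have /andP[e0 e1] := eta_itv.
rewrite (w_even _ jk)// (w_odd _ jk)//.
have jE := odd_double_half j; rewrite [mu k.+1 j]mu_add//.
set a := mu k.+2 j.*2; set b := mu k.+2 j.*2.+1; set W := w k.+1 j in w0 *.
pose X := a - b - (-1) ^+ odd j * eta * (a + b).
have NE : N%:R * eta = 1 :> R by rewrite divff// pnatr_eq0 -lt0n (leq_trans _ N16).
have DE : jump k j = N%:R ^+ k.+1 * X.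
  have ab : a + b = mu k.+1 j by rewrite -mu_add.
  rewrite /jump /tree_value -/a -/b /X /= ab.
  have -> : N%:R ^+ k.+1 * (a - b - (-1) ^+ odd j * eta * mu k.+1 j) =
      N%:R ^+ k.+1 * (a - b) - (-1) ^+ odd j * (N%:R ^+ k * (N%:R * eta)) * mu k.+1 j.
    by rewrite !exprS; ring.
  rewrite NE mulr1; move: jE; case: (odd j) => /= jE.
    have jp : j.-1 = j./2.*2 by rewrite -{1}jE.
    have jj : mu k.+1 j = mu k.+1 j./2.*2.+1 by rewrite -{1}jE.
    by rewrite jp jj; ring.
  have jp : j.+1 = j./2.*2.+1 by rewrite -{1}jE.
  have jj : mu k.+1 j = mu k.+1 j./2.*2 by rewrite -{1}jE.
  by rewrite jp jj; ring.
have -> : s k.+1 j * jump k j ^+ 2 = X ^+ 2 / W.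
  have NL := mulr_Npow R N16 k.+1.
  have -> : X ^+ 2 = (N%:R ^+ k.+1 * Npow R N k.+1) ^+ 2 * X ^+ 2.
    by rewrite NL expr1n mul1r.
  by rewrite DE; ring.
have X2 : 0 <= X ^+ 2 / W by rewrite divr_ge0 ?sqr_ge0// ltW.
have e2 : 0 < 1 - eta ^+ 2 by nra.
have e3 : 1 <= (1 - eta ^+ 2)^-1.
  by rewrite -[leLHS]invr1 lef_pV2 ?posrE// gerBl sqr_ge0.
(* The right-hand side of the claim is exactly X^2 / (W (1 - eta^2)): the variance identity for a
   split into masses (1 + eta) / 2 and (1 - eta) / 2. *)
apply: (@le_trans _ _ ((1 - eta ^+ 2)^-1 * (X ^+ 2 / W))); first by rewrite ler_peMl.
rewrite le_eqVlt; apply/orP; left; apply/eqP; rewrite /X.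
have [W0 n1 n2] : [/\ W != 0, 1 - eta != 0 & 1 + eta != 0].
  by split; rewrite gt_eqF//; lra.
have n3 : 1 - eta ^+ 2 != 0 by rewrite gt_eqF.
move: n1 n2 n3; move: (eta) => h n1 n2 n3.
by case: (odd j); rewrite ?expr0 ?expr1; field; rewrite W0 n1 n2 n3.
Qed.

(** Squared lengths shrink by eta^2 while masses are nearly halved: the exact ratio is 4 eta^2 / (1
    - eta^2), or 4 eta^2 at the evenly split root, well below 1/4 for eta <= 1/16. *)
Let s_children k j : (j < 2 ^ k)%N ->
  s k.+1 j.*2 + s k.+1 j.*2.+1 <= s k j / 4.
Proof.
move=> jk; have w0 := w_gt0 jk; have /andP[e0 e1] := eta_itv.
have lE : Npow R N k.+1 = eta * Npow R N k.
  by rewrite (NpowS R N16 k) mulrA mulVf ?mul1r// gt_eqF// -invr_gt0.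
have l0 : 0 < Npow R N k ^+ 2 by rewrite exprn_gt0// Npow_gt0.
rewrite lE; case: k jk w0 l0 {lE} => [|k] jk w0 l0.
  move: jk; rewrite expn0; case: j w0 => // w0 _; rewrite w00 w10 w11.
  by rewrite Npow0 expr1n; nra.
rewrite (w_even _ jk)// (w_odd _ jk)//.
move: l0 w0; set L := _ ^+ 2; set W := w _ _ => l0 w0.
rewrite exprMn -/L.
have LW : 0 < L / W by rewrite divr_gt0.
have [W0 n1 n2] : [/\ W != 0, 1 - eta != 0 & 1 + eta != 0].
  by split; rewrite gt_eqF//; lra.
have e2 : 0 < 1 - eta ^+ 2 by nra.
have n3 : 1 - eta ^+ 2 != 0 by rewrite gt_eqF.
have -> : eta ^+ 2 * L / ((if odd j then 1 - eta else 1 + eta) / 2 * W) +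
    eta ^+ 2 * L / ((if odd j then 1 + eta else 1 - eta) / 2 * W) =
    4 * eta ^+ 2 / (1 - eta ^+ 2) * (L / W).
  move: n1 n2 n3; move: (eta) => h n1 n2 n3.
  by case: odd; field; rewrite W0 n1 n2 n3.
rewrite [leRHS]mulrC ler_pM2r// ler_pdivrMr//.
by nra.
Qed.

Let A k := \sum_(0 <= j < 2 ^ k) s k j * tree_value k j ^+ 2.
(** If [mu] comes from a function, this is the squared L^2 norm of its conditional expectation on
    generation k. *)
Let V k := \sum_(0 <= j < 2 ^ k) mu k j ^+ 2 / w k j.
Let B k := \sum_(0 <= j < 2 ^ k.+1) s k.+1 j * jump k j ^+ 2.

Let s_ge0 k j : (j < 2 ^ k)%N -> 0 <= s k j.
Proof. by move=> jk; rewrite divr_ge0 ?sqr_ge0// ltW// w_gt0. Qed.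

Let BV k : B k <= V k.+2 - V k.+1.
Proof.
rewrite /V sum_nat_dyadicS -sumrB; apply: ler_sum_nat => j /andP[_ jk].
exact: jump_bound.
Qed.

(** From (u + v)^2 <= 2 u^2 + 2 v^2: the factor 2 is affordable because the children weigh at most a
    quarter of their parent. *)
Let AS k : A k.+1 <= A k / 2 + 2 * B k.
Proof.
apply: (@le_trans _ _ (\sum_(0 <= j < 2 ^ k.+1)
   (2 * (s k.+1 j * tree_value k j./2 ^+ 2) + 2 * (s k.+1 j * jump k j ^+ 2)))).
  apply: ler_sum_nat => j /andP[_ jk].
  have -> : tree_value k.+1 j = tree_value k j./2 + jump k j.
    by rewrite /jump addrC subrK.
  have := s_ge0 jk; set S := s k.+1 j => S0.
  set u := tree_value _ _; set v := jump _ _.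
  rewrite -subr_ge0 (_ : _ - _ = S * (u - v) ^+ 2); last by ring.
  by rewrite mulr_ge0 ?sqr_ge0.
rewrite big_split/= -mulr_sumr -mulr_sumr lerD2r sum_nat_dyadicS mulr_sumr.
rewrite /A mulr_suml; apply: ler_sum_nat => j /andP[_ jk].
rewrite doubleK /= uphalf_double -mulrDl.
have := s_children jk; have := sqr_ge0 (tree_value k j); nra.
Qed.

Lemma sum_tree_value_le n :
  \sum_(0 <= k < n) \sum_(0 <= j < 2 ^ k) s k j * tree_value k j ^+ 2 <= 4 * V n.
Proof.
have V0 k : 0 <= V k.
  rewrite /V big_nat_cond sumr_ge0// => j /andP[/andP[_ jk] _].
  by rewrite divr_ge0 ?sqr_ge0// ltW// w_gt0.
have A0 k : 0 <= A k.
  rewrite /A big_nat_cond sumr_ge0// => j /andP[/andP[_ jk] _].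
  by rewrite mulr_ge0 ?s_ge0 ?sqr_ge0.
case: n => [|n]; first by rewrite big_geq// mulr_ge0.
(* The extra [A n] closes the induction: the step adds 2 A(n+1) - A(n), which is at most 4 B(n), and
   [BV] telescopes. This is where the constant 4 arises. *)
suff : \sum_(0 <= k < n.+1) A k + A n <= 4 * V n.+1.
  by apply: le_trans; rewrite lerDl.
elim: n => [|n IH].
  rewrite big_nat1 /A /V expn0 expn1 big_nat1 big_nat_recr//= big_nat1.
  rewrite /tree_value/= w00 w10 w11 Npow0 expr0 expr1n.
  have := sqr_ge0 (mu 1 0 + mu 1 1); nra.
rewrite big_nat_recr//=; have := AS n; have := BV n; move: IH.
by set t := \sum_(_ <= _ < _) _; lra.
Qed.

End DyadicMartingale.

(** * Integrals carried together with integrability *)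

Section HasIntegral.
Context d (T : measurableType d) (R : realType) (mu : {measure set T -> \bar R}).
Implicit Types (A B : set T) (f g : T -> R) (u v : R).

(** Both halves are assembled along the tree in one pass: (ii) asks for absolute convergence, which
    the value of the integral alone does not express. *)
Definition has_int A f v :=
  mu.-integrable A (EFin \o f) /\ (\int[mu]_(x in A) (f x)%:E = v%:E)%E.

Lemma has_int_fine A f : measurable A -> mu.-integrable A (EFin \o f) ->
  has_int A f (fine (\int[mu]_(x in A) (f x)%:E)).
Proof.
by move=> mA fi; split=> //; rewrite fineK//; exact: integrable_fin_num.
Qed.

Lemma eq_has_int A f g v : measurable A -> (forall x, A x -> f x = g x) ->
  has_int A f v -> has_int A g v.
Proof.
move=> mA fg [fi fv]; split.
  by apply: (eq_integrable mA) fi => x; rewrite inE/= => /fg ->.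
by rewrite -fv; apply: eq_integral => x; rewrite inE => /fg ->.
Qed.

Lemma has_intZ A f v c : measurable A -> has_int A f v ->
  has_int A (fun x => c * f x) (c * v).
Proof.
move=> mA [fi fv]; split.
  exact: (integrableZl mA c fi).
rewrite EFinM -fv -(integralZl mA fi).
by apply: eq_integral => x _; rewrite EFinM.
Qed.

Lemma has_intD A f g u v : measurable A -> has_int A f u -> has_int A g v ->
  has_int A (fun x => f x + g x) (u + v).
Proof.
move=> mA [fi fv] [gi gv]; split; first exact: (integrableD mA fi gi).
rewrite EFinD -fv -gv -(integralD mA fi gi).
by apply: eq_integral => x _; rewrite EFinD.
Qed.

Lemma has_int_ge0 A f v : (forall x, A x -> 0 <= f x) -> has_int A f v -> 0 <= v.
Proof.
by move=> f0 [_ fv]; rewrite -lee_fin -fv; apply: integral_ge0 => x /f0.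
Qed.

Lemma has_int_null A f : measurable A -> measurable_fun A f -> mu A = 0%E ->
  has_int A f 0.
Proof.
move=> mA mf A0; have mf' : measurable_fun A (EFin \o f) by exact/measurable_EFinP.
by split; [exact: null_set_integrable|exact: null_set_integral].
Qed.

Lemma has_intU A B f u v : measurable A -> measurable B -> A `&` B = set0 ->
  has_int A f u -> has_int B f v -> has_int (A `|` B) f (u + v).
Proof.
move=> mA mB AB [/integrableP[mfA fA] fu] [/integrableP[mfB fB] fv].
have mf : measurable_fun (A `|` B) (EFin \o f) by apply/measurable_funU.
have dAB : [disjoint A & B] by rewrite disj_set2E AB.
have fi : mu.-integrable (A `|` B) (EFin \o f).
  apply/integrableP; split=> //.
  rewrite ge0_integral_setU//; last exact: measurableT_comp.
  by rewrite lte_add_pinfty.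
split=> //; rewrite EFinD -fu -fv integral_setU_EFin//.
exact/measurable_EFinP.
Qed.

Lemma has_int_uniq A f u v : has_int A f u -> has_int A f v -> u = v.
Proof. by move=> [_ uE] [_]; rewrite uE => -[]. Qed.

End HasIntegral.

(** * Masses of the Cantor intervals and integration along the tree *)

Section RedistributedCantorMeasure.
Variables (R : realType) (N : nat) (omega : {measure set R -> \bar R}).
Hypotheses (N16 : (16 <= N)%N) (omegaE : omega_hat_spec N omega).
Local Notation eta := ((N%:R : R)^-1).
Local Notation I := (@cantor_int R N).
Local Notation gap := (@gap R N).
Implicit Types (k j : nat) (A : set R) (f : R -> R).

Let mI k j : measurable (I k j). Proof. exact: measurable_cantor_int. Qed.

Let mgap k j : measurable (gap k j). Proof. exact: measurable_gap. Qed.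

Let gap_children k j : gap k j `&` (I k.+1 j.*2 `|` I k.+1 j.*2.+1) = set0.
Proof.
apply/seteqP; split=> // x [/gapP/andP[g1 g2] [|] /cantor_intP].
  by rewrite cantor_left_even leNgt => /andP[_]; rewrite leNgt g1.
by rewrite cantor_left_odd addrA leNgt g2.
Qed.

Definition cantor_mass k j := fine (omega (I k j)).
Local Notation w := cantor_mass.

Let omegaT : omega setT = 1%E. Proof. by have [] := omegaE. Qed.

Let omega_le1 A : measurable A -> (omega A <= 1)%E.
Proof. by move=> mA; rewrite -omegaT le_measure ?inE. Qed.

Let omega_fin A : measurable A -> omega A \is a fin_num.
Proof.
move=> mA; rewrite ge0_fin_numE//.
by rewrite (le_lt_trans (omega_le1 mA))// ltry.
Qed.

Lemma cantor_massE k j : omega (I k j) = (w k j)%:E.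
Proof. by rewrite fineK// omega_fin. Qed.

Lemma cantor_mass10 : w 1 0 = 1 / 2.
Proof. by have [_ [_ [+ _]]] := omegaE; rewrite cantor_massE => -[]. Qed.

Lemma cantor_mass11 : w 1 1 = 1 / 2.
Proof. by have [_ [_ [_ [+ _]]]] := omegaE; rewrite cantor_massE => -[]. Qed.

Let omega_decomp k j :
  omega (I k j) = (omega (gap k j) + (omega (I k.+1 j.*2) + omega (I k.+1 j.*2.+1)))%E.
Proof.
rewrite (cantor_int_decomp R N16) measureU//; last exact: measurableU.
by rewrite [in LHS]measureU//; apply: (cantor_children_disjoint R N16).
Qed.

(** Squeezed between the total mass 1 and the two prescribed masses 1/2 of generation 1. *)
Lemma cantor_mass00 : w 0 0 = 1.
Proof.
apply/eqP; rewrite eq_le -!lee_fin -cantor_massE omega_le1//=.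
rewrite omega_decomp !cantor_massE cantor_mass10 cantor_mass11.
by rewrite -EFinD -splitr leeDr.
Qed.

Lemma cantor_mass_even k j : (1 <= k)%N -> (j < 2 ^ k)%N ->
  w k.+1 j.*2 = (if odd j then 1 - eta else 1 + eta) / 2 * w k j.
Proof.
move=> k1 jk; have [_ [_ [_ [_ /(_ k j k1 jk)[+ _]]]]] := omegaE.
by rewrite !cantor_massE -EFinM => -[].
Qed.

Lemma cantor_mass_odd k j : (1 <= k)%N -> (j < 2 ^ k)%N ->
  w k.+1 j.*2.+1 = (if odd j then 1 + eta else 1 - eta) / 2 * w k j.
Proof.
move=> k1 jk; have [_ [_ [_ [_ /(_ k j k1 jk)[_ +]]]]] := omegaE.
by rewrite !cantor_massE -EFinM => -[].
Qed.

Lemma cantor_mass_add k j : (j < 2 ^ k)%N ->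
  w k j = w k.+1 j.*2 + w k.+1 j.*2.+1.
Proof.
case: k => [|k] jk.
  move: jk; rewrite expn0; case: j => // _.
  by rewrite cantor_mass00 cantor_mass10 cantor_mass11 -splitr.
by rewrite cantor_mass_even// cantor_mass_odd//; move: eta => h; case: odd; field.
Qed.

Lemma cantor_mass_gt0 k j : (j < 2 ^ k)%N -> 0 < w k j.
Proof.
have e0 : 0 < eta by rewrite invr_gt0 ltr0n (leq_trans _ N16).
have e1 : eta < 1 by rewrite invf_lt1 ?ltr1n ?ltr0n (leq_trans _ N16).
elim: k j => [|[|k] IH] j jk.
- by move: jk; rewrite expn0; case: j => // _; rewrite cantor_mass00.
- by move: jk; case: j => [|[|//]] _; rewrite ?cantor_mass10 ?cantor_mass11 divr_gt0.
have jk' : (j./2 < 2 ^ k.+1)%N by rewrite ltn_half_double -mul2n -expnS.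
have := IH _ jk'; rewrite -[in w _ j](odd_double_half j).
case: (odd j); rewrite ?add1n ?add0n => h.
  by rewrite cantor_mass_odd// mulr_gt0// divr_gt0//; case: ifP => _; lra.
by rewrite cantor_mass_even// mulr_gt0// divr_gt0//; case: ifP => _; lra.
Qed.

(** The children already exhaust the mass of their parent. *)
Let omega_gap k j : (j < 2 ^ k)%N -> omega (gap k j) = 0%E.
Proof.
move=> jk; have := omega_decomp k j; rewrite !cantor_massE.
have := omega_fin (mgap k j); move/fineK => <-; rewrite -!EFinD => -[].
by rewrite {1}cantor_mass_add// => /eqP; rewrite eq_sym addrC -subr_eq0 addrK => /eqP ->.
Qed.

Let omega_outside : omega (~` I 0 0) = 0%E.
Proof.
have : (1 = omega (I 0 0) + omega (~` I 0 0))%E.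
  by rewrite -omegaT -measureU ?setUv ?setICr//; exact: measurableC.
rewrite cantor_massE cantor_mass00.
have := omega_fin (measurableC (mI 0 0)); move/fineK => <-; rewrite -EFinD => -[].
by move/eqP; rewrite eq_sym addrC -subr_eq0 addrK => /eqP ->.
Qed.

Let has_int_gap k j f : (j < 2 ^ k)%N -> measurable_fun setT f ->
  has_int omega (gap k j) f 0.
Proof.
move=> jk mf; apply: has_int_null => //; last exact: omega_gap.
exact: measurable_funTS.
Qed.

Lemma has_int_cantorS k j f u v : (j < 2 ^ k)%N -> measurable_fun setT f ->
  has_int omega (I k.+1 j.*2) f u -> has_int omega (I k.+1 j.*2.+1) f v ->
  has_int omega (I k j) f (u + v).
Proof.
move=> jk mf fu fv; rewrite (cantor_int_decomp R N16) -[u + v]add0r.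
apply: has_intU => //; [exact: measurableU|exact: has_int_gap|].
by apply: has_intU => //; exact: (cantor_children_disjoint R N16).
Qed.

Lemma has_int_outer_left k j f u v : (j < 2 ^ k)%N -> measurable_fun setT f ->
  has_int omega (~` I k j) f u -> has_int omega (I k.+1 j.*2.+1) f v ->
  has_int omega (~` I k.+1 j.*2) f (u + v).
Proof.
move=> jk mf fu fv.
have -> : ~` I k.+1 j.*2 = ~` I k j `|` (gap k j `|` I k.+1 j.*2.+1).
  have D := cantor_int_decomp R N16 k j.
  apply/seteqP; split=> [x /= nx|x [nx|[gx|rx]] lx].
  - have [|] := pselect (I k j x); last by left.
    by rewrite D => -[gx|[//|rx]]; right; [left|right].
  - by apply: nx; rewrite D; right; left.
  - by have : set0 x by rewrite -(gap_children k j); split=> //; left.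
  - by have : set0 x by rewrite -(cantor_children_disjoint R N16 k j).
rewrite -[v]add0r; apply: has_intU => //; first exact: measurableC.
- exact: measurableU.
- apply/seteqP; split=> // x [nx [gx|rx]]; apply: nx.
    exact: (@gap_sub R N N16 k j x gx).
  exact: (@cantor_int_right R N N16 k j x rx).
apply: has_intU => //; last exact: has_int_gap.
by apply: subsetI_eq0 (gap_children k j) => // x; right.
Qed.

Lemma has_int_outer_right k j f u v : (j < 2 ^ k)%N -> measurable_fun setT f ->
  has_int omega (~` I k j) f u -> has_int omega (I k.+1 j.*2) f v ->
  has_int omega (~` I k.+1 j.*2.+1) f (u + v).
Proof.
move=> jk mf fu fv.
have -> : ~` I k.+1 j.*2.+1 = ~` I k j `|` (gap k j `|` I k.+1 j.*2).
  have D := cantor_int_decomp R N16 k j.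
  apply/seteqP; split=> [x /= nx|x [nx|[gx|rx]] lx].
  - have [|] := pselect (I k j x); last by left.
    by rewrite D => -[gx|[rx|//]]; right; [left|right].
  - by apply: nx; rewrite D; right; right.
  - by have : set0 x by rewrite -(gap_children k j); split=> //; right.
  - by have : set0 x by rewrite -(cantor_children_disjoint R N16 k j).
rewrite -[v]add0r; apply: has_intU => //; first exact: measurableC.
- exact: measurableU.
- apply/seteqP; split=> // x [nx [gx|rx]]; apply: nx.
    exact: (@gap_sub R N N16 k j x gx).
  exact: (@cantor_int_left R N N16 k j x rx).
apply: has_intU => //; last exact: has_int_gap.
by apply: subsetI_eq0 (gap_children k j) => // x; left.
Qed.

Lemma has_int_outside f : measurable_fun setT f -> has_int omega (~` I 0 0) f 0.
Proof.
move=> mf; apply: has_int_null => //; [exact: measurableC|].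
exact: measurable_funTS.
Qed.

(** * The transform of a square-integrable density on the central intervals *)

Section FlatTransform.
Variables (rho : R) (K : R -> R).
Hypotheses (rho_itv : 2 / 3 <= rho < 1) (KE : Kflat_spec N rho K).
Variable g : R -> R.
Hypothesis mg : measurable_fun setT g.
Hypothesis g2_fin : (\int[omega]_x ((g x) ^+ 2)%:E < +oo)%E.

Let g2_int : omega.-integrable setT (EFin \o (fun x => g x ^+ 2)).
Proof.
apply/integrableP; split.
  by apply/measurable_EFinP; exact: measurable_funX.
rewrite (eq_integral (fun x => ((g x) ^+ 2)%:E))// => x _.
by rewrite /= ger0_norm// sqr_ge0.
Qed.

Let cst_int A : measurable A -> has_int omega A (cst 1) (fine (omega A)).
Proof.
move=> mA; have cE : (\int[omega]_(x in A) (cst 1 x)%:E = omega A)%E.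
  by rewrite (integral_cst omega mA 1) mul1e.
rewrite -cE; apply: has_int_fine => //.
apply/integrableP; split; first by apply/measurable_EFinP.
rewrite (eq_integral (cst 1%E)); last by move=> x _; rewrite /= normr1.
by rewrite integral_cst// mul1e (le_lt_trans (omega_le1 mA))// ltry.
Qed.

Let g_int : omega.-integrable setT (EFin \o g).
Proof.
have [ci _] := cst_int measurableT.
(* The majorant is 1 + g^2, integrable because omega is finite. *)
apply: (le_integrable measurableT _ _ (integrableD measurableT ci g2_int)).
  exact/measurable_EFinP.
move=> x _; rewrite /= lee_fin [leRHS]ger0_norm ?addr_ge0 ?sqr_ge0//.
have := real_normK (num_real (g x)); have := normr_ge0 (g x).
by move: `|g x| => t t0 <-; nra.
Qed.

Definition cantor_integral k j := fine (\int[omega]_(x in I k j) (g x)%:E).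
Local Notation mu := cantor_integral.

Lemma has_int_cantor_integral k j : has_int omega (I k j) g (mu k j).
Proof. by apply: has_int_fine => //; exact: integrableS g_int. Qed.

Lemma cantor_integral_add k j : (j < 2 ^ k)%N ->
  mu k j = mu k.+1 j.*2 + mu k.+1 j.*2.+1.
Proof.
move=> jk; apply: (has_int_uniq (has_int_cantor_integral k j)).
by apply: has_int_cantorS => //; exact: has_int_cantor_integral.
Qed.

Let q k j := fine (\int[omega]_(x in I k j) ((g x) ^+ 2)%:E).

Let has_int_q k j : has_int omega (I k j) (fun x => g x ^+ 2) (q k j).
Proof. by apply: has_int_fine => //; exact: integrableS g2_int. Qed.

Let q_add k j : (j < 2 ^ k)%N -> q k j = q k.+1 j.*2 + q k.+1 j.*2.+1.
Proof.
move=> jk; apply: (has_int_uniq (has_int_q k j)).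
by apply: has_int_cantorS => //; exact: measurable_funX.
Qed.

(** Cauchy-Schwarz as nonnegativity of the variance: (g - t)^2 is integrated with t the mean of
    g. *)
Let cauchy_schwarz k j : (j < 2 ^ k)%N -> mu k j ^+ 2 / w k j <= q k j.
Proof.
move=> jk; have w0 := cantor_mass_gt0 jk.
set m := mu k j; set W := w k j in w0 *; pose t := m / W.
have H : has_int omega (I k j) (fun x => (g x - t) ^+ 2)
    (q k j + ((- (2 * t)) * m + t ^+ 2 * W)).
  apply: (eq_has_int (mI k j) (f := fun x => g x ^+ 2 + (- (2 * t) * g x + t ^+ 2 * cst 1 x))).
    by move=> x _ /=; ring.
  apply: has_intD => //; apply: has_intD => //; apply: has_intZ => //.
    exact: has_int_cantor_integral.
  exact: cst_int.
have := has_int_ge0 (fun x _ => sqr_ge0 (g x - t)) H.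
have -> : q k j + (- (2 * t) * m + t ^+ 2 * W) = q k j - m ^+ 2 / W.
  by rewrite /t; field; rewrite gt_eqF.
by rewrite subr_ge0.
Qed.

Let sum_q n : \sum_(0 <= j < 2 ^ n) q n j = q 0 0.
Proof.
elim: n => [|n IH]; first by rewrite expn0 big_nat1.
rewrite sum_nat_dyadicS -IH; apply: eq_big_nat => j /andP[_ jn].
by rewrite -q_add.
Qed.

Lemma tree_energy_bound n :
  ((\sum_(0 <= k < n) \sum_(0 <= j < 2 ^ k)
     s_hat N omega k j * tree_value N mu k j ^+ 2)%:E
  <= 4%:E * \int[omega]_x ((g x) ^+ 2)%:E)%E.
Proof.
have q00 : (q 0 0)%:E = (\int[omega]_x ((g x) ^+ 2)%:E)%E.
  have mg2 : measurable_fun setT (fun x => g x ^+ 2) by exact: measurable_funX.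
  have [_] := has_intU (mI 0 0) (measurableC (mI 0 0)) (setICr _)
    (has_int_q 0 0) (has_int_outside mg2).
  by rewrite setUv addr0 => ->.
rewrite -q00 -EFinM lee_fin.
apply: le_trans (@sum_tree_value_le R N w mu N16 cantor_mass_gt0 cantor_mass00
  cantor_mass10 cantor_mass11 cantor_mass_even cantor_mass_odd cantor_integral_add n) _.
rewrite ler_pM2l// -(sum_q n); apply: ler_sum_nat => j /andP[_ jn].
exact: cauchy_schwarz.
Qed.

Lemma measurable_Kflat_mul (y : R) :
  measurable_fun setT (fun x : R => K (y - x) * g x).
Proof.
apply: measurable_funM => //; apply: measurableT_comp.
  exact: Kflat_measurable N16 rho_itv KE.
by apply: measurable_funB.
Qed.

Let K_pos k (x y : R) :
  3 / 8 <= N%:R ^+ k * (y - x) <= 8 / 3 -> K (y - x) = N%:R ^+ k.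
Proof. exact: (Kflat_one_scaled N16 rho_itv KE). Qed.

Let K_neg k (x y : R) :
  3 / 8 <= N%:R ^+ k * (x - y) <= 8 / 3 -> K (y - x) = - N%:R ^+ k.
Proof.
move=> h; rewrite -(K_pos h) -opprB.
have xy0 : x - y != 0.
  apply/eqP => xy; move: h; rewrite xy mulr0 => /andP[+ _].
  by rewrite leNgt divr_gt0.
by rewrite (scale_homogeneousN (Kflat_homogeneous N16 KE) xy0) expr1 mulN1r.
Qed.

Let has_int_K_cst k j c (y : R) : (forall x, I k j x -> K (y - x) = c) ->
  has_int omega (I k j) (fun x => K (y - x) * g x) (c * mu k j).
Proof.
move=> Kc; apply: (eq_has_int (mI k j) (f := fun x => c * g x)).
  by move=> x /Kc ->.
by apply: has_intZ => //; exact: has_int_cantor_integral.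
Qed.

(** Here y ranges over all of I^k_j, because the induction passes to the parent, where y is no
    longer central. *)
Let has_int_outer_value k j (y : R) : (j < 2 ^ k)%N -> I k j y ->
  has_int omega (~` I k j) (fun x => K (y - x) * g x) (outer_value N mu k j).
Proof.
elim: k j => [|k IH] j jk yj.
  move: jk; rewrite expn0; case: j yj => // _ _.
  by apply: has_int_outside; exact: measurable_Kflat_mul.
have jk' : (j./2 < 2 ^ k)%N by rewrite ltn_half_double -mul2n -expnS.
have H := IH _ jk' (@cantor_int_half R N N16 k j y yj).
have mK := measurable_Kflat_mul y.
have jE := odd_double_half j.
rewrite [outer_value _ _ _ _]/=; move: jE yj; case: (odd j) => /= jE yj.
  have jp : j.-1 = j./2.*2 by rewrite -{1}jE.
  rewrite -[in ~` _]jE jp; apply: has_int_outer_right => //.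
  apply: has_int_K_cst => x xj; apply: K_pos.
  have yj' : I k.+1 j./2.*2.+1 y by move: yj; rewrite -{1}jE.
  exact: (sibling_dist N16 xj yj').
have jp : j.+1 = j./2.*2.+1 by rewrite -{1}jE.
rewrite -[in ~` _]jE jp; apply: has_int_outer_left => //.
rewrite -mulNr; apply: has_int_K_cst => x xj; apply: K_neg.
have yj' : I k.+1 j./2.*2 y by rewrite -[_.*2]add0n jE.
exact: (sibling_dist N16 yj' xj).
Qed.

Lemma has_int_tree_value k j (y : R) : (j < 2 ^ k)%N -> Lint N k j y ->
  has_int omega setT (fun x => K (y - x) * g x) (tree_value N mu k j).
Proof.
move=> jk yL; have mK := measurable_Kflat_mul y.
have yj : I k j y by apply: (@gap_sub R N N16); exact: (@Lint_gap R N N16 k j).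
rewrite -(setvU (I k j)); apply: has_intU => //.
- exact: measurableC.
- exact: setICl.
- exact: has_int_outer_value.
rewrite mulrBr -mulNr; apply: has_int_cantorS => //; apply: has_int_K_cst => x xj.
  by apply: K_pos; exact: (Lint_left_dist N16 yL xj).
by apply: K_neg; exact: (Lint_right_dist N16 yL xj).
Qed.

End FlatTransform.
End RedistributedCantorMeasure.

(** * Bounds for integrals of possibly nonmeasurable functions *)

Section NonmeasurableIntegrands.
Local Open Scope ereal_scope.
Context d (T : measurableType d) (R : realType) (mu : {measure set T -> \bar R}).

(* The integral of a nonnegative function is a supremum over simple functions,
   hence monotone without measurability of the integrands. *)
Lemma ge0_le_lower_integral (D : set T) (f1 f2 : T -> \bar R) :
  (forall x, D x -> 0 <= f1 x) -> (forall x, D x -> f1 x <= f2 x) ->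
  \int[mu]_(x in D) f1 x <= \int[mu]_(x in D) f2 x.
Proof.
move=> f10 f12.
have f20 x : D x -> 0 <= f2 x by move=> Dx; apply: le_trans (f12 x Dx); exact: f10.
rewrite !ge0_integralE//; apply: le_ereal_sup => _ [h /= hf <-].
exists h => //= x; apply: (le_trans (hf x)).
by rewrite /patch; case: ifPn => //; rewrite inE => /f12.
Qed.

(** A Chebyshev inequality; without measurability of f it applies directly to the inner integral of
    the energy as a function of the outer variable. *)
Lemma ge_cst_integral (D A : set T) (f : T -> \bar R) (c : R) :
  measurable D -> measurable A -> A `<=` D -> (0 <= c)%R ->
  (forall x, D x -> 0 <= f x) -> (forall x, A x -> c%:E <= f x) ->
  c%:E * mu A <= \int[mu]_(x in D) f x.
Proof.
move=> mD mA AD c0 f0 cf; rewrite -integral_cst// -(setIidr AD) integral_mkcondr.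
apply: ge0_le_lower_integral => x Dx; rewrite /patch; case: ifPn => //=.
- by rewrite inE => /cf.
- by move=> _; exact: f0.
Qed.

End NonmeasurableIntegrands.

Lemma eseries_single (R : realType) (f : nat -> \bar R) m :
  (forall i, i != m -> f i = 0%E) -> (\sum_(i <oo) f i = f m)%E.
Proof.
move=> f0; apply: lim_near_cst => //; exists m.+1 => // n /= mn.
rewrite (bigD1_seq m) ?iota_uniq//= ?mem_index_iota//.
by rewrite big1 ?adde0// => i /f0.
Qed.

(** * The measure sigma on gaps and integrals against it *)

Section SigmaHat.
Variables (R : realType) (N : nat) (omega sigma : {measure set R -> \bar R}).
Hypotheses (N16 : (16 <= N)%N) (omegaE : omega_hat_spec N omega)
  (sigmaE : sigma_hat_spec N omega sigma).
Local Notation ell k := (Npow R N k).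
Local Notation L := (@Lint R N).
Local Notation I := (@cantor_int R N).
Local Notation gap := (@gap R N).
Local Notation s := (s_hat N omega).
Local Notation w := (cantor_mass N omega).
Implicit Types (k j : nat) (A : set R).

Let mL k j : measurable (L k j). Proof. exact: measurable_Lint. Qed.

Let e0 k : 0 < ell k. Proof. exact: Npow_gt0. Qed.

Lemma s_hat_gt0 k j : (j < 2 ^ k)%N -> 0 < s k j.
Proof.
by move=> jk; rewrite /s_hat divr_gt0 ?exprn_gt0// cantor_mass_gt0.
Qed.

Lemma sigma_hat_gap k j A : (j < 2 ^ k)%N -> measurable A -> A `<=` gap k j ->
  sigma A = ((s k j / (2 * ell k.+1))%:E * lebesgue_measure (A `&` L k j))%E.
Proof.
move=> jk mA Agap; rewrite sigmaE//.
have Z m i : (i < 2 ^ m)%N -> (m, i) <> (k, j) -> A `&` L m i = set0.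
  move=> im mi; apply/seteqP; split=> // x [/Agap gx lx].
  by have [mk ij] := gap_Lint_inj N16 jk im gx lx; apply: mi; rewrite mk ij.
rewrite (eseries_single (m := k)).
  rewrite big_mkord (bigD1 (Ordinal jk))//= big1 ?adde0// => i ij.
  rewrite Z ?measure0 ?mule0// => -[ik]; move: ij => /eqP; apply.
  exact: val_inj.
move=> m mk; rewrite big_nat_cond big1// => i /andP[/andP[_ im] _].
by rewrite Z ?measure0 ?mule0// => -[/eqP]; rewrite (negbTE mk).
Qed.

Lemma lebesgue_measure_segment (a b : R) : a <= b ->
  lebesgue_measure `[a, b]%classic = (b - a)%:E.
Proof.
move=> ab; rewrite lebesgue_measure_itv/= lte_fin; case: ifPn => [_//|].
by rewrite -leNgt => ba; rewrite (@le_anti _ _ a b) ?subrr// ab ba.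
Qed.

Lemma sigma_hat_segment k j (a b : R) : (j < 2 ^ k)%N -> a <= b ->
  cantor_center R N k j - ell k.+1 <= a -> b <= cantor_center R N k j + ell k.+1 ->
  sigma `[a, b]%classic = (s k j / (2 * ell k.+1) * (b - a))%:E.
Proof.
move=> jk ab La Lb.
have abL : `[a, b]%classic `<=` L k j.
  move=> x /=; rewrite /Lint/= !in_itv/= => /andP[ax xb].
  by rewrite (le_trans La)//= (le_trans xb).
rewrite (sigma_hat_gap jk)//; last first.
  by apply: (subset_trans abL); exact: Lint_gap.
by rewrite (setIidl abL) lebesgue_measure_segment.
Qed.

Lemma sigma_hat_Lint k j : (j < 2 ^ k)%N -> sigma (L k j) = (s k j)%:E.
Proof.
move=> jk; rewrite (@sigma_hat_segment k j)//; last by rewrite lerD2l ge0_cp// ltW.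
congr EFin; rewrite -[RHS]mulr1; have := e0 k.+1; move: (ell _) => t t0.
by field; rewrite gt_eqF.
Qed.

Lemma sigma_hat_gapT k j : (j < 2 ^ k)%N -> sigma (gap k j) = (s k j)%:E.
Proof.
move=> jk; rewrite -sigma_hat_Lint// [LHS](sigma_hat_gap jk)//; last exact: measurable_gap.
rewrite [RHS](sigma_hat_gap jk)//; last exact: Lint_gap.
by rewrite setIid setIidr//; exact: Lint_gap.
Qed.

Let U := \bigcup_k \bigcup_(j in [set j | (j < 2 ^ k)%N]) L k j.

Let mU : measurable U.
Proof. by apply: bigcup_measurable => k _; apply: bigcup_measurable. Qed.

Let sigma_outside : sigma (~` U) = 0%E.
Proof.
rewrite sigmaE; last exact: measurableC.
rewrite eseries0// => k _ _; rewrite big_nat_cond big1// => j /andP[/andP[_ jk] _].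
rewrite (_ : ~` U `&` L k j = set0) ?measure0 ?mule0//.
by apply/seteqP; split=> // x [Ux Lx]; apply: Ux; exists k => //; exists j.
Qed.

Lemma sigma_hat_integral_le (f : R -> \bar R) (c : nat -> nat -> R) (B : \bar R) :
  (forall x, (0 <= f x)%E) -> (forall k j, 0 <= c k j) ->
  (forall k j x, (j < 2 ^ k)%N -> L k j x -> (f x <= (c k j)%:E)%E) ->
  (forall n, ((\sum_(0 <= k < n) \sum_(0 <= j < 2 ^ k) s k j * c k j)%:E <= B)%E) ->
  (\int[sigma]_x f x <= B)%E.
Proof.
move=> f0 c0 fc cB.
pose F k (x : R) : \bar R := (\sum_(0 <= j < 2 ^ k) (c k j)%:E * (\1_(L k j) x)%:E)%E.
pose h1 (x : R) : \bar R := (\sum_(k <oo) F k x)%E.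
(* Off the central intervals nothing is known about f, so the majorant is +oo there, at no cost
   since sigma does not charge that set. *)
pose h2 : R -> \bar R := (cst +oo%E) \_ (~` U).
have T0 k j (x : R) : (0 <= (c k j)%:E * (\1_(L k j) x)%:E)%E.
  by rewrite mule_ge0// lee_fin.
have F0 k x : (0 <= F k x)%E by apply: sume_ge0 => j _; exact: T0.
have mT k j : measurable_fun setT (fun x : R => ((c k j)%:E * (\1_(L k j) x)%:E)%E).
  apply: emeasurable_funM => //; apply/measurable_EFinP; exact: measurable_indic.
have mF k : measurable_fun setT (F k) by apply: emeasurable_sum => j; exact: mT.
have mh1 : measurable_fun setT h1 by apply: ge0_emeasurable_sum => // k x _ _.
have mh2 : measurable_fun setT h2.
  by apply/(measurable_restrictT _ _).1 => //; exact: measurableC.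
have h10 x : (0 <= h1 x)%E by apply: nneseries_ge0.
have h20 x : (0 <= h2 x)%E by rewrite /h2 /patch; case: ifP => // _; rewrite leey.
have fh x : (f x <= h1 x + h2 x)%E.
  have [[k _ [j /= jk Lx]]|nU] := pselect (U x).
    apply: (le_trans (fc _ _ _ jk Lx)); apply: (@le_trans _ _ (h1 x)); last by rewrite leeDl.
    apply: (@le_trans _ _ (F k x)).
      rewrite /F big_mkord (bigD1 (Ordinal jk))//= indicE mem_set// mule1 leeDl//.
      by apply: sume_ge0 => i _; exact: T0.
    apply: (@le_trans _ _ (\sum_(0 <= i < k.+1) F i x)%E).
      by rewrite big_nat_recr//= leeDr// sume_ge0.
    exact: nneseries_lim_ge.
  by rewrite /h2 /patch mem_set//= addey ?leey// -ltNye (lt_le_trans _ (h10 x)).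
apply: (le_trans (ge0_le_lower_integral sigma (fun x _ => f0 x) (fun x _ => fh x))).
rewrite ge0_integralD// [X in (_ + X)%E](_ : _ = 0%E) ?adde0; last first.
  rewrite /h2 -integral_mkcond integral_cst ?sigma_outside ?mule0//.
  exact: measurableC.
rewrite integral_nneseries//.
apply: lime_le; first by apply: is_cvg_nneseries => k _ _; exact: integral_ge0.
apply: nearW => n; apply: le_trans (cB n).
rewrite -sumEFin; apply: lee_sum => k _.
rewrite ge0_integral_sum//.
rewrite big_nat_cond [in leRHS]big_nat_cond -sumEFin; apply: lee_sum => j /andP[/andP[_ jk] _].
rewrite ge0_integralZl//; last 2 first.
- by apply/measurable_EFinP; exact: measurable_indic.
- by rewrite lee_fin.
by rewrite integral_indic// setIT sigma_hat_Lint// -EFinM mulrC.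
Qed.

End SigmaHat.

(** * Failure of the backward energy condition *)

Section BackwardEnergy.
Variables (R : realType) (N : nat) (omega sigma : {measure set R -> \bar R}).
Hypotheses (N16 : (16 <= N)%N) (omegaE : omega_hat_spec N omega)
  (sigmaE : sigma_hat_spec N omega sigma).
Local Notation ell k := (Npow R N k).
Local Notation left := (cantor_left R N).
Local Notation s := (s_hat N omega).
Local Notation w := (cantor_mass N omega).
Implicit Types (k j n : nat) (J : interval R).

Lemma benergy_term_ge0 I0 J : (0 <= benergy_term sigma omega I0 J)%E.
Proof.
rewrite /benergy_term; case: ifP => // _.
(* For endpoints in reverse order [itv_len] is negative, and so may be the Poisson integral; its
   square is therefore treated in both signs. *)
have P2 (p : \bar R) : (0 <= p * p)%E.
  by have [p0|p0] := leP 0%E p; [rewrite mule_ge0|rewrite mule_le0// ltW].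
apply: mule_ge0 => //; apply: mule_ge0 => //; apply: mule_ge0.
  by rewrite lee_fin divr_ge0// invr_ge0 sqr_ge0.
by apply: integral_ge0 => x _; apply: integral_ge0 => y _; rewrite lee_fin sqr_ge0.
Qed.

Definition cantor_itv k j : interval R := `[left k j, left k j + ell k].

Definition gap_itv k j : interval R :=
  `]left k j + ell k.+1, left k j + ell k - ell k.+1[.

Let e0 k : 0 < ell k. Proof. exact: Npow_gt0. Qed.

Let len k := ell k - ell k.+1 - ell k.+1.

Let len_gt0 k : 0 < len k.
Proof. by rewrite /len; have := NpowS_le R N16 k; have := e0 k.+1; lra. Qed.

Let gap_len k j : itv_len (gap_itv k j) = len k.
Proof. by rewrite /itv_len/= /len; ring. Qed.

Let sigma_gap k j : (j < 2 ^ k)%N -> sigma [set` gap_itv k j] = (s k j)%:E.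
Proof. exact: (sigma_hat_gapT N16 sigmaE). Qed.

(* Only the outer quarters of L^k_j are used, so that |x - x'| >= N^-(k+1). *)
Lemma gap_energy2_ge k j : (j < 2 ^ k)%N ->
  (((ell k.+1 / len k) ^+ 2 / 32)%:E <= energy2 (gap_itv k j) sigma)%E.
Proof.
move=> jk; have l0 := len_gt0 k; have ep := e0 k.+1.
have s0 := s_hat_gt0 N16 omegaE jk.
rewrite /energy2 sigma_gap// gap_len.
set q := (ell k.+1 / len k) ^+ 2.
set c := cantor_center R N k j.
pose A := `[c - ell k.+1, c - ell k.+1 / 2]%classic.
pose B := `[c + ell k.+1 / 2, c + ell k.+1]%classic.
have ABgap : A `<=` [set` gap_itv k j] /\ B `<=` [set` gap_itv k j].
  split=> x; rewrite /A /B /= in_itv/= => /andP[x1 x2];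
  apply: (@Lint_gap R N N16 k j); rewrite /Lint /= in_itv/= -/c; apply/andP; lra.
have [sA sB] : sigma A = (s k j / 4)%:E /\ sigma B = (s k j / 4)%:E.
  have h1 : c - ell k.+1 <= c - ell k.+1 / 2 by lra.
  have h2 : c - ell k.+1 / 2 <= c + ell k.+1 by lra.
  have h3 : c + ell k.+1 / 2 <= c + ell k.+1 by lra.
  have h4 : c - ell k.+1 <= c + ell k.+1 / 2 by lra.
  rewrite (sigma_hat_segment N16 sigmaE jk h1 (lexx _) h2).
  rewrite (sigma_hat_segment N16 sigmaE jk h3 h4 (lexx _)).
  by split; congr EFin; field; rewrite gt_eqF.
have mA : measurable A by exact: measurable_itv.
have mB : measurable B by exact: measurable_itv.
have mG : measurable [set` gap_itv k j] by exact: measurable_itv.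
have q0 : 0 <= q by exact: sqr_ge0.
have inner x : A x ->
    ((q * (s k j / 4))%:E <=
     \int[sigma]_(y in [set` gap_itv k j]) (((x - y) / len k) ^+ 2)%:E)%E.
  move=> Ax; rewrite EFinM -sB; apply: ge_cst_integral => //.
  - by case: ABgap.
  - by move=> y _; rewrite lee_fin sqr_ge0.
  move=> y By; rewrite lee_fin /q !expr_div_n ler_pM2r ?invr_gt0 ?exprn_gt0//.
  rewrite -[leRHS]sqrrN opprB lerXn2r ?nnegrE ?(ltW ep)//.
    by move: Ax By; rewrite /A /B/= !in_itv/= => /andP[a1 a2] /andP[b1 b2]; lra.
  by move: Ax By; rewrite /A /B/= !in_itv/= => /andP[a1 a2] /andP[b1 b2]; lra.
have outer := @ge_cst_integral _ _ R sigma [set` gap_itv k j] A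
  (fun x => \int[sigma]_(y in [set` gap_itv k j]) (((x - y) / len k) ^+ 2)%:E)%E
  (q * (s k j / 4)).
(* 1/32 is the factor 1/2 of the energy times (1/4)^2, as each of [A] and [B] carries a quarter of
   the mass of the gap. *)
have -> : (q / 32)%:E = (((s k j) ^- 2 / 2)%:E * ((q * (s k j / 4))%:E * sigma A))%E.
  rewrite sA -!EFinM; congr EFin; move: s0; move: (s k j) => t t0.
  by field; rewrite gt_eqF.
rewrite lee_pmul2l//; last by rewrite lte_fin divr_gt0// invr_gt0 exprn_gt0.
apply: outer => //.
- by case: ABgap.
- by rewrite mulr_ge0// divr_ge0// ltW.
- by move=> x _; apply: integral_ge0 => y _; rewrite lee_fin sqr_ge0.
Qed.

Let cantor_int_sub0 k j : (j < 2 ^ k)%N ->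
  cantor_int N k j `<=` [set` cantor_itv 0 0].
Proof.
elim: k j => [|k IH] j jk; first by move: jk; rewrite expn0; case: j => // _;
  exact: subset_refl.
have jk' : (j./2 < 2 ^ k)%N by rewrite ltn_half_double -mul2n -expnS.
exact: subset_trans (@cantor_int_half R N N16 k j) (IH _ jk').
Qed.

(** Only the mass of I^k_j is kept: its points lie within N^-(k+1) of the gap, so length plus
    distance is at most N^-k. *)
Lemma gap_poisson_ge k j : (j < 2 ^ k)%N ->
  ((len k / ell k ^+ 2 * w k j)%:E <=
   poisson (gap_itv k j) omega [set` cantor_itv 0 0])%E.
Proof.
move=> jk; have l0 := len_gt0 k; have ep := e0 k.+1; have ek := e0 k.
rewrite EFinM -cantor_massE// /poisson gap_len.
apply: ge_cst_integral => //.
- exact: measurable_itv.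
- exact: cantor_int_sub0.
- by rewrite divr_ge0 ?sqr_ge0// ltW.
- by move=> x _; rewrite lee_fin divr_ge0 ?sqr_ge0// ltW.
move=> x /cantor_intP/andP[x1 x2]; rewrite lee_fin ler_pM2l//.
set dd := itv_dist _ x.
have [d0 d1] : 0 <= dd /\ dd <= ell k.+1.
  rewrite /dd /itv_dist/=; split; first by rewrite le_max lexx.
  rewrite !ge_max (ltW ep)/=; apply/andP; lra.
rewrite lef_pV2 ?posrE ?exprn_gt0//; last by rewrite ltr_wpDr.
by rewrite lerXn2r ?nnegrE ?(ltW ek)//; move: l0; rewrite /len; lra.
Qed.

(** The gap length cancels between energy and Poisson integral, and s * w = N^(-2k) does the
    rest. *)
Lemma benergy_gap_ge k j : (j < 2 ^ k)%N ->
  ((w k j / (32 * N%:R ^+ 2))%:E <=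
   benergy_term sigma omega (cantor_itv 0 0) (gap_itv k j))%E.
Proof.
move=> jk; have l0 := len_gt0 k; have ep := e0 k.+1; have ek := e0 k.
have s0 := s_hat_gt0 N16 omegaE jk; have w0 := cantor_mass_gt0 N16 omegaE jk.
rewrite /benergy_term sigma_gap// eqe gt_eqF//.
have sE : s k j = ell k ^+ 2 / w k j by [].
have -> : w k j / (32 * N%:R ^+ 2) = s k j * ((ell k.+1 / len k) ^+ 2 / 32) *
    ((len k / ell k ^+ 2 * w k j) * (len k / ell k ^+ 2 * w k j)).
  have N0 : N%:R != 0 :> R by rewrite pnatr_eq0 -lt0n (leq_trans _ N16).
  rewrite sE (NpowS R N16 k); move: l0 ep w0.
  move: (ell k.+1) (len k) (w k j) => e l W l0 ep w0.
  by field; rewrite N0 !gt_eqF.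
rewrite !EFinM; have p0 : (0 <= (len k / ell k ^+ 2)%:E * (w k j)%:E)%E.
  by rewrite -EFinM lee_fin mulr_ge0 ?divr_ge0 ?sqr_ge0// ltW.
have p := gap_poisson_ge jk; rewrite EFinM in p.
have q := gap_energy2_ge jk; rewrite EFinM in q.
apply: lee_pmul => //.
- by rewrite -!EFinM lee_fin mulr_ge0 ?divr_ge0 ?sqr_ge0// ltW.
- by rewrite mule_ge0.
- by rewrite lee_pmul2l.
- by apply: lee_pmul.
Qed.

(* Cutting off the gaps of the first n generations inside I^k_j, each generation
   contributes a fixed multiple of the mass of I^k_j. *)
Lemma energy_decomposition n k j : (j < 2 ^ k)%N -> exists l : seq (interval R),
  [/\ forall J, J \in l -> bounded_itv J,
      forall x, (x \in cantor_itv k j) = has (fun J => x \in J) l,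
      pairwise (fun J J' => `[< [set` J] `&` [set` J'] = set0 >]) l &
      (((w k j / (32 * N%:R ^+ 2)) *+ n)%:E <=
       \sum_(J <- l) benergy_term sigma omega (cantor_itv 0 0) J)%E].
Proof.
elim: n k j => [|n IH] k j jk.
  (* The last remaining intervals only complete the partition; of their terms only nonnegativity is
     used. *)
  exists [:: cantor_itv k j]; split=> //.
  - by move=> J; rewrite inE => /eqP ->.
  - by move=> x /=; rewrite orbF.
  - by rewrite mulr0n big_seq1 benergy_term_ge0.
have jk1 : (j.*2 < 2 ^ k.+1)%N by rewrite expnS mul2n ltn_double.
have jk2 : (j.*2.+1 < 2 ^ k.+1)%N by rewrite expnS mul2n ltn_Sdouble.
have [l1 [b1 u1 d1 s1]] := IH _ _ jk1; have [l2 [b2 u2 d2 s2]] := IH _ _ jk2.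
have sub1 J x : J \in l1 -> x \in J -> cantor_int N k.+1 j.*2 x.
  by move=> Jl xJ; rewrite /cantor_int/= -/(cantor_itv _ _) u1; apply/hasP; exists J.
have sub2 J x : J \in l2 -> x \in J -> cantor_int N k.+1 j.*2.+1 x.
  by move=> Jl xJ; rewrite /cantor_int/= -/(cantor_itv _ _) u2; apply/hasP; exists J.
exists (gap_itv k j :: l1 ++ l2); split.
- move=> J; rewrite inE mem_cat => /orP[/eqP ->//|/orP[|]]; [exact: b1|exact: b2].
- move=> x; rewrite /= has_cat -u1 -u2.
  have D : cantor_int N k j x <->
      (gap N k j `|` (cantor_int N k.+1 j.*2 `|` cantor_int N k.+1 j.*2.+1)) x.
    by rewrite -(cantor_int_decomp R N16).
  apply/idP/idP => [/D[->//|[h|h]]|/orP[h|/orP[h|h]]].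
  + by apply/orP; right; apply/orP; left.
  + by apply/orP; right; apply/orP; right.
  + by apply/D; left.
  + by apply/D; right; left.
  + by apply/D; right; right.
- rewrite pairwise_cons pairwise_cat d1 d2 !andbT; apply/andP; split.
    apply/allP => J; rewrite mem_cat => Jl; apply/asboolP/seteqP; split=> // x [gx Jx].
    move: Jl => /orP[Jl|Jl].
      exact: (gap_disjoint_int N16 jk jk1 (ltnSn k) gx (sub1 _ _ Jl Jx)).
    exact: (gap_disjoint_int N16 jk jk2 (ltnSn k) gx (sub2 _ _ Jl Jx)).
  apply/allrelP => J J' Jl J'l; apply/asboolP/seteqP; split=> // x [Jx J'x].
  rewrite -(cantor_children_disjoint R N16 k j).
  by split; [exact: sub1 Jl Jx|exact: sub2 J'l J'x].
rewrite big_cons big_cat/= mulrS EFinD leeD//; first exact: benergy_gap_ge.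
apply: le_trans (leeD s1 s2); rewrite -EFinD lee_fin.
by rewrite (cantor_mass_add N16 omegaE jk) mulrDl mulrnDl.
Qed.

Lemma backward_energy_unbounded (M : R) :
  exists (I0 : interval R) (Is : nat -> interval R),
    bounded_itv I0 /\ (0 < omega [set` I0])%E /\
    (forall r, bounded_itv (Is r)) /\
    [set` I0] = \bigcup_(r in [set: nat]) [set` Is r] /\
    trivIset [set: nat] (fun r => [set` Is r]) /\
    (M%:E < (fine (omega [set` I0]))^-1%:E *
              \sum_(r <oo) benergy_term sigma omega I0 (Is r))%E.
Proof.
have oE : omega [set` cantor_itv 0 0] = 1%E.
  by rewrite -[RHS](congr1 EFin (cantor_mass00 N16 omegaE)) -(cantor_massE omegaE).
pose C : R := (32 * N%:R ^+ 2)^-1.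
have C0 : 0 < C by rewrite invr_gt0 mulr_gt0// exprn_gt0// ltr0n (leq_trans _ N16).
pose n := Num.truncn (`|M| / C).
have nM : M < C *+ n.+1.
  rewrite -mulr_natl -ltr_pdivrMr//; apply: le_lt_trans (truncnS_gt _).
  by rewrite ler_wpM2r ?ler_norm// invr_ge0 ltW.
have [l [bl ul dl sl]] := @energy_decomposition n.+1 0 0 isT.
(* An empty interval pads the finite decomposition to an infinite sequence. *)
pose e : interval R := `]0, 0[.
have e0' : [set` e] = set0.
  by apply/seteqP; split=> // x /=; rewrite in_itv/= => /andP[h /(lt_trans h)]; rewrite ltxx.
exists (cantor_itv 0 0), (nth e l); split=> //; split; first by rewrite oE.
split.
  move=> r; have [rl|lr] := ltnP r (size l); first by apply: bl; exact: mem_nth.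
  by rewrite nth_default.
split.
  apply/seteqP; split=> x /=.
    rewrite ul => /hasP[J Jl xJ]; exists (index J l) => //=.
    by rewrite nth_index.
  move=> [r _ /=]; have [rl|lr] := ltnP r (size l) => xr; last first.
    have : [set` e] x by move: xr; rewrite nth_default.
    by rewrite e0'.
  by rewrite ul; apply/hasP; exists (nth e l r) => //; exact: mem_nth.
split.
  apply/trivIsetP => r r' _ _.
  wlog rr : r r' / (r < r')%N.
    move=> H; rewrite neq_ltn => /orP[h|h]; first by apply: H => //; rewrite neq_ltn h.
    by rewrite setIC; apply: H => //; rewrite neq_ltn h.
  move=> _; have [r'l|lr] := ltnP r' (size l); last first.
    by rewrite (nth_default _ lr) e0' setI0.
  have /asboolP// := (pairwiseP e dl) r r' (ltn_trans rr r'l) r'l rr.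
rewrite oE/= invr1 mul1e.
apply: (@lt_le_trans _ _ (\sum_(J <- l) benergy_term sigma omega (cantor_itv 0 0) J)%E).
  by apply: lt_le_trans sl; rewrite cantor_mass00// div1r lte_fin.
rewrite (big_nth e).
by apply: nneseries_lim_ge => r _ _; exact: benergy_term_ge0.
Qed.

End BackwardEnergy.

Theorem theorem1 :
  exists N0 : nat, (16 <= N0)%N /\
  forall (R : realType) (N : nat) (rho : R) (K : R -> R)
         (omega sigma : {measure set R -> \bar R}),
    (N0 <= N)%N -> 2 / 3 <= rho < 1 ->
    Kflat_spec N rho K -> omega_hat_spec N omega -> sigma_hat_spec N omega sigma ->
    (* (i) *)
    ((forall x : R, x != 0 -> K (- x) = - K x) /\
     (forall (n : nat) (x : R), x != 0 -> derivable (derive1n n K) x 1) /\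
     std_CZ_kernel (fun x y : R => K (x - y)) /\
     (exists c C : R, 0 < c /\ c <= C /\
        forall x : R, x != 0 -> c / `|x| <= `|K x| <= C / `|x|)) /\
    (* (ii) *)
    (exists C : R, forall g : R -> R,
       measurable_fun setT g ->
       (\int[omega]_x ((g x) ^+ 2)%:E < +oo)%E ->
       (forall y : R, (exists k j : nat, (j < 2 ^ k)%N /\ Lint N k j y) ->
          omega.-integrable setT (fun x => (K (y - x) * g x)%:E)) /\
       (\int[sigma]_y ((fine (\int[omega]_x (K (y - x) * g x)%:E)) ^+ 2)%:E
          <= C%:E * \int[omega]_x ((g x) ^+ 2)%:E)%E) /\
    (* (iii) *)
    (forall M : R, exists (I0 : interval R) (Is : nat -> interval R),
       bounded_itv I0 /\ (0 < omega [set` I0])%E /\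
       (forall r, bounded_itv (Is r)) /\
       [set` I0] = \bigcup_(r in [set: nat]) [set` Is r] /\
       trivIset [set: nat] (fun r => [set` Is r]) /\
       (M%:E < (fine (omega [set` I0]))^-1%:E *
                 \sum_(r <oo) benergy_term sigma omega I0 (Is r))%E).
Proof.
(* N = 16 already brings every normalized distance into the plateau and makes the weights
   contract. *)
exists 16%N; split=> // R N rho K omega sigma N16 rho_itv KE omegaE sigmaE.
split; [split; [|split; [|split]]|split].
- by have [_ [_ [_ [_ [_ [_ [_ Kodd]]]]]]] := KE.
- by move=> n x; exact: (Kflat_derivable N16 rho_itv KE).
- exact: (Kflat_std_CZ N16 rho_itv KE).
- exact: (Kflat_elliptic N16 KE).
(* The constant of [sum_tree_value_le], independent of [N] and [rho]. *)
- exists 4 => g mg g2.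
  have H k j y := has_int_tree_value N16 omegaE rho_itv KE mg g2 (k := k) (j := j) (y := y).
  split=> [y [k [j [jk Ly]]]|]; first by have [] := H k j y jk Ly.
  apply: (sigma_hat_integral_le N16 sigmaE
    (c := fun k j => tree_value N (cantor_integral N omega g) k j ^+ 2)).
  + by move=> y; rewrite lee_fin sqr_ge0.
  + by move=> k j; exact: sqr_ge0.
  + by move=> k j y jk Ly; have [_ ->] := H k j y jk Ly.
  + by move=> n; exact: tree_energy_bound.
- exact: (backward_energy_unbounded N16 omegaE sigmaE).
Qed.
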